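(* For every $\kappa \in (0,1/2)$ and every real number $\kappa' > 0$ there exists a constant $C > 0$, depending only on $\kappa$ and $\kappa'$, such that the following holds for every $\varepsilon > 0$. Let $F = F(t,x) : [0,1]\times\mathbb{T}^2 \to \mathbb{R}^2$ be a smooth time-dependent vector field on $\mathbb{T}^2$ with associated flow $\Phi_t : \mathbb{T}^2 \to \mathbb{T}^2$, $t \in [0,1]$, i.e. the solution of $$\dot{\Phi}_t(x) = F(t,\Phi_t(x)), \qquad \Phi_0(x) = x.$$ Assume that $$0 < \kappa' \leqslant \left| \det[\nabla_x \Phi_t(x)] \right| \quad \text{for all } t \in [0,1],\ x \in \mathbb{T}^2,$$ and that $\Phi = \Phi_1$ mixes the set $A = \{(x_1,x_2) \in \mathbb{T}^2 : 0 \leqslant x_2 < 1/2\}$ up to scale $\varepsilon$ (with constant $\kappa$). Then $$\frac{C}{\varepsilon^2} \leqslant \int_0^1 \int_{\mathbb{T}^2} e^{\sqrt{6}\, |\nabla_x F(t,x)|}\, d\sigma\, dt.$$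
   Context: $\mathbb{T}^2 = \mathbb{R}^2/\mathbb{Z}^2$ is the flat two-dimensional torus with coordinates $x = (x_1,x_2) \in [0,1)\times[0,1)$, and $d\sigma$ and $\mathrm{Area}$ denote its standard area measure. $B_\varepsilon(x)$ is the ball in $\mathbb{T}^2$ of radius $\varepsilon$ centered at $x$, for the flat metric. For $\kappa \in (0,1/2)$, a diffeomorphism $\Phi : \mathbb{T}^2 \to \mathbb{T}^2$ mixes the set $A$ up to scale $\varepsilon$ (with constant $\kappa$) if for every $x \in \mathbb{T}^2$ $$\kappa\, \mathrm{Area}(B_\varepsilon(x)) \leqslant \mathrm{Area}(B_\varepsilon(x) \cap \Phi(A)) \leqslant (1-\kappa)\, \mathrm{Area}(B_\varepsilon(x)).$$ $\nabla_x\Phi_t$ denotes the $2\times2$ Jacobian matrix of $\Phi_t$ in the coordinates of $\mathbb{T}^2$ (computed from local lifts to $\mathbb{R}^2$). For the vector field $F = (F^1,F^2)$, $$|\nabla_x F| = \left( \sum_{i,j=1}^2 (\partial_{x_i} F^j)^2 \right)^{1/2}.$$ *)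

(* Defs.v *)
From HB Require Import structures.
From mathcomp Require Export all_boot all_order all_algebra.
From mathcomp Require Export all_classical all_reals all_analysis.

Set Implicit Arguments.
Unset Strict Implicit.
Unset Printing Implicit Defensive.

Import Order.TTheory GRing.Theory Num.Theory.
Import numFieldNormedType.Exports.

Local Open Scope classical_set_scope.
Local Open Scope ring_scope.

(** The torus [R^2/Z^2] is represented by the fundamental domain [[0,1[ x [0,1[].
    Functions on the torus are given as [Z^2]-periodic functions on [R * R], and
    maps from the torus to itself by their lifts to [R * R]; [torus_proj] sends
    a point of the plane to the representative of its class. *)
Section Torus.
Context {R : realType}.

Definition torus : set (R * R) := `[0, 1[ `*` `[0, 1[.

Definition torus_proj (x : R * R) : R * R :=
  (x.1 - (Num.floor x.1)%:~R, x.2 - (Num.floor x.2)%:~R).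

Definition zvec (k : int * int) : R * R := (k.1%:~R, k.2%:~R).

(** The norm of the library on [R * R] is the sup norm, hence the explicit
    Euclidean distance. *)
Definition euclid_dist (x y : R * R) : R :=
  Num.sqrt ((x.1 - y.1) ^+ 2 + (x.2 - y.2) ^+ 2).

Definition torus_dist (x y : R * R) : R :=
  inf (range (fun k : int * int => euclid_dist x (y + zvec k))).

Definition torus_ball (x : R * R) (eps : R) : set (R * R) :=
  [set y | torus y /\ torus_dist x y < eps].

Definition leb2 : set (measurableTypeR R * measurableTypeR R) -> \bar R :=
  (@lebesgue_measure R \x @lebesgue_measure R)%E.

HB.instance Definition _ := Measure.on leb2.

(** [f] maps representatives to representatives, and [A] is a set of
    representatives. *)
Definition mixes (kappa : R) (f : R * R -> R * R) (A : set (R * R)) (eps : R) :=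
  forall x, torus x ->
    (kappa%:E * leb2 (torus_ball x eps)
       <= leb2 (torus_ball x eps `&` f @` A))%E /\
    (leb2 (torus_ball x eps `&` f @` A)
       <= (1 - kappa)%:E * leb2 (torus_ball x eps))%E.

Definition lower_half : set (R * R) :=
  [set x | torus x /\ 0 <= x.2 < 2^-1].

End Torus.

Section Calculus.
Context {R : realType}.

Definition basis_vec (i : 'I_2) : R * R := if i == 0 then (1, 0) else (0, 1).

Definition coord2 (i : 'I_2) (x : R * R) : R := if i == 0 then x.1 else x.2.

(** Entry [(i, j)] is the partial derivative of the [j]-th component in the
    [i]-th variable, the row-vector convention of ['J]. *)
Definition jac (G : R * R -> R * R) (x : R * R) : 'M[R]_2 :=
  \matrix_(i, j) 'D_(basis_vec i) (fun y => coord2 j (G y)) x.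

Definition frobenius (M : 'M[R]_2) : R :=
  Num.sqrt (\sum_(i < 2) \sum_(j < 2) M i j ^+ 2).

(** Derivative at [t] relative to [[0,1]]: one-sided at the end points. *)
Definition is_time_derive (f : R -> R * R) (t : R) (l : R * R) : Prop :=
  (s - t)^-1 *: (f s - f t) @[s --> within `[0, 1] t^'] --> l.

(** [C^n] on [[0,1] x R^2]: the partial derivatives up to order [n] exist
    (one-sided in time at [t = 0, 1]) and are jointly continuous there. *)
Fixpoint Cn_on_strip (n : nat) (F : R -> R * R -> R * R) : Prop :=
  {within `[0, 1] `*` [set: R * R],
     continuous (fun p : R * (R * R) => F p.1 p.2)} /\
  if n is m.+1 then
    exists (Ft : R -> R * R -> R * R) (Fx : 'I_2 -> R -> R * R -> R * R),
      [/\ forall t x, 0 <= t <= 1 -> is_time_derive (F ^~ x) t (Ft t x),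
          forall i t x, 0 <= t <= 1 ->
            is_derive x (basis_vec i) (F t) (Fx i t x),
          Cn_on_strip m Ft
        & forall i, Cn_on_strip m (Fx i)]
  else True.

Definition smooth_torus_field (F : R -> R * R -> R * R) : Prop :=
  (forall n, Cn_on_strip n F) /\
  (forall t x k, 0 <= t <= 1 -> F t (x + zvec k) = F t x).

(** [Phi t] is the lift to [R^2], starting from the identity, of the time-[t]
    flow map of the torus. By uniqueness of the solutions it satisfies
    [Phi t (x + zvec k) = Phi t x + zvec k]. *)
Definition is_lifted_flow (F Phi : R -> R * R -> R * R) : Prop :=
  (forall x, Phi 0 x = x) /\
  (forall t x, 0 <= t <= 1 -> is_time_derive (Phi ^~ x) t (F t (Phi t x))).

End Calculus.

(* Main.v *)
From HB Require Import structures.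
Require Import Defs.
From mathcomp Require Import all_boot all_order all_algebra.
From mathcomp Require Import all_classical all_reals all_analysis.
From mathcomp Require Import measurable_realfun.
From mathcomp Require Import ring lra zify.

Set Implicit Arguments.
Unset Strict Implicit.
Unset Printing Implicit Defensive.

Import Order.TTheory GRing.Theory Num.Theory.
Import numFieldNormedType.Exports.

Local Open Scope classical_set_scope.
Local Open Scope ring_scope.

(** The image under [Phi 1] of the half torus [0 <= x_2 < 1/2] is bounded by
    the images of two horizontal circles. Mixing at scale [eps] forces this
    boundary to be long, of length at least of order [1/eps]: from every point of
    the torus, a proportion [kappa] of the displacements of length less than
    [eps] leads out of the image ([mixing_lower]), while a displacement that
    carries an interior point out of the image has to cross the boundary.

    The length of the boundary is controlled by the stretching of horizontal
    lines. Along the trajectory of [x], the length of a tangent vector grows at a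
    logarithmic rate at most [|nabla F|], so that by Gronwall's and Jensen's
    inequalities [|nabla Phi_1(x)|^2] is at most
    [S(x) = int_0^1 exp (2 |nabla F(t, Phi_t x)|) dt] ([flow_stretch]). Since
    [Phi_t] contracts areas at most by the factor [kappa'], the average of [S]
    over the torus is at most [1/kappa'] times the integral of
    [exp (2 |nabla F|)] ([stretch_sum]). By the Cauchy-Schwarz inequality, a well
    chosen horizontal circle has an image of length at most the square root of a
    multiple of this integral. Hence [1/eps^2] is bounded by a multiple of the
    integral of [exp (2 |nabla F|)], and [2 <= sqrt 6].

    The proof runs this argument on a grid of mesh [1/N], with [N] large
    depending on [F] and [eps]. The integral of [S] is replaced by a sum over the
    centres of the grid squares; the area bound, in [transport], rests on the
    disjointness of the images of these squares and on the lower bound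
    [image_box_area] of their areas. The image of a row of the grid is covered by
    boxes of radii [sqrt S / N] around the images of the centres ([curve_cover]).
    Two rows with small sums of [S] are chosen by the pigeonhole principle
    ([row_pigeonhole]), one at a height in [[0, 1/8[] and one in [[3/8, 1/2[].
    For a fixed displacement [h] of length less than [eps], the points of the
    image of the inner strip [1/8 <= x_2 < 3/8] which [h] carries out of the
    image of the half torus lie in these boxes enlarged by [eps], thus in a set
    of area at most [16 eps] times the sum of the radii ([defect_measure]).
    Integrating over [h] and exchanging the order of integration
    ([double_counting]) bounds [kappa] times the area of the image of the inner
    strip, which is at least [kappa'/64] ([inner_strip_area]), by that quantity. *)

(** * Norms and mean value estimates in the plane *)

Section plane.
Context {R : realType}.
Implicit Types (v w : R * R).

(** The squared Euclidean norm, smooth, serves for the energy estimates; the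
    [l^1] norm serves for the error terms. *)
Definition sqn v : R := v.1 ^+ 2 + v.2 ^+ 2.
Definition l1norm v : R := `|v.1| + `|v.2|.

Lemma sqn_ge0 v : 0 <= sqn v.
Proof. by rewrite addr_ge0// sqr_ge0. Qed.

Lemma l1norm_ge0 v : 0 <= l1norm v.
Proof. by rewrite addr_ge0. Qed.

Lemma sqn_le_l1norm v : sqn v <= l1norm v ^+ 2.
Proof.
rewrite /sqn /l1norm -(real_normK (num_real v.1)) -(real_normK (num_real v.2)).
have := normr_ge0 v.1; have := normr_ge0 v.2; nra.
Qed.

Lemma l1norm_le_sqn v : l1norm v ^+ 2 <= 2 * sqn v.
Proof.
rewrite /sqn /l1norm -(real_normK (num_real v.1)) -(real_normK (num_real v.2)).
by have := sqr_ge0 (`|v.1| - `|v.2|); nra.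
Qed.

Lemma l1norm_le_of_sqn (K : R) v w : 0 <= K ->
  sqn v <= K ^+ 2 * sqn w -> l1norm v <= 2 * K * l1norm w.
Proof.
move=> K0 vw; have w0 := l1norm_ge0 w.
rewrite -ler_sqr ?nnegrE ?l1norm_ge0 ?mulr_ge0//.
have := l1norm_le_sqn v; have := sqn_le_l1norm w; have := sqr_ge0 K => K2 h1 h2.
have : K ^+ 2 * sqn w <= K ^+ 2 * l1norm w ^+ 2 by rewrite ler_wpM2l.
have := sqr_ge0 (l1norm v); rewrite !exprMn; lra.
Qed.

Lemma cvg_pairP {T : Type} (F : set_system T) {FF : Filter F}
    (f : T -> R * R) (l : R * R) :
  f @ F --> l <-> ((fun t => (f t).1) @ F --> l.1 /\ (fun t => (f t).2) @ F --> l.2).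
Proof.
case: l => l1 l2; split=> [fl|[f1 f2]].
  split; first by apply: (@cvg_comp _ _ _ f fst F (nbhs (l1, l2)) _ fl); exact: cvg_fst.
  by apply: (@cvg_comp _ _ _ f snd F (nbhs (l1, l2)) _ fl); exact: cvg_snd.
have -> : f = (fun t => ((f t).1, (f t).2)) by apply/funext => t; case: (f t).
exact: cvg_pair f1 f2.
Qed.

Lemma is_deriveP {V W : normedModType R} (f : V -> W) (a v : V) (l : W) :
  is_derive a v f l <->
  (fun h : R => h^-1 *: (f (h *: v + a) - f a)) @ 0^' --> l.
Proof.
split=> [[df <-]|h]; first exact: df.
by split; [apply/cvg_ex; exists l|exact: cvg_lim].
Qed.

Lemma is_derive_fst (V : normedModType R) (f : V -> R * R) (a v : V) (l : R * R) :
  is_derive a v f l -> is_derive a v (fun t => (f t).1) l.1.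
Proof. by move=> /is_deriveP/cvg_pairP[h _]; apply/is_deriveP. Qed.

Lemma is_derive_snd (V : normedModType R) (f : V -> R * R) (a v : V) (l : R * R) :
  is_derive a v f l -> is_derive a v (fun t => (f t).2) l.2.
Proof. by move=> /is_deriveP/cvg_pairP[_ h]; apply/is_deriveP. Qed.

Lemma is_derive_coord2 (V : normedModType R) (f : V -> R * R) (a v : V) l i :
  is_derive a v f l -> is_derive a v (fun t => coord2 i (f t)) (coord2 i l).
Proof.
rewrite /coord2; case: ifP => _; [exact: is_derive_fst|exact: is_derive_snd].
Qed.

Lemma is_derive_hline (f : R * R -> R) (s t l : R) :
  is_derive (s, t) (1, 0) f l -> is_derive s 1 (fun s => f (s, t)) l.
Proof.
move=> /is_deriveP h; apply/is_deriveP; apply: cvg_trans h; apply: near_eq_cvg.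
by near=> u; congr (_ *: (f _ - _)); congr pair; rewrite /= scaler0 add0r.
Unshelve. all: by end_near. Qed.

Lemma is_derive_vline (f : R * R -> R) (s t l : R) :
  is_derive (s, t) (0, 1) f l -> is_derive t 1 (fun t => f (s, t)) l.
Proof.
move=> /is_deriveP h; apply/is_deriveP; apply: cvg_trans h; apply: near_eq_cvg.
by near=> u; congr (_ *: (f _ - _)); congr pair; rewrite /= scaler0 add0r.
Unshelve. all: by end_near. Qed.

Lemma MVT_line (f df : R -> R) (a b : R) :
  (forall x : R, is_derive x 1 f (df x)) ->
  exists2 c, `|c - a| <= `|b - a| & f b - f a = df c * (b - a).
Proof.
move=> dfx.
have cf : continuous f.
  by move=> x; apply/differentiable_continuous/derivable1_diffP; case: (dfx x).
have [ab|ba] := leP a b.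
  have [c] := MVT_segment ab (fun x _ => dfx x) (continuous_subspaceT cf).
  by rewrite in_itv/= => /andP[ac cb] E; exists c => //; rewrite !ger0_norm; lra.
have [c] := MVT_segment (ltW ba) (fun x _ => dfx x) (continuous_subspaceT cf).
rewrite in_itv/= => /andP[ac cb] E; exists c; first by rewrite !ler0_norm; lra.
by move: E; lra.
Qed.

Section taylor.
Variables (f f1 f2 : R * R -> R).
Hypothesis d1 : forall x : R * R, is_derive x (1, 0) f (f1 x).
Hypothesis d2 : forall x : R * R, is_derive x (0, 1) f (f2 x).

(** The increment of [f] from [x] to [y] is split at the corner [(x.1, y.2)], so
    that the mean value theorem applies along each axis. *)
Lemma MVT_plane (x y : R * R) : exists u w : R * R,
  [/\ l1norm (u - x) <= l1norm (y - x), l1norm (w - x) <= l1norm (y - x)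
    & f y - f x = f1 u * (y.1 - x.1) + f2 w * (y.2 - x.2)].
Proof.
case: x y => x1 x2 [y1 y2].
have [c cx Ec] := @MVT_line (fun s => f (s, y2)) (fun s => f1 (s, y2)) x1 y1
  (fun s => is_derive_hline (d1 _)).
have [d dx Ed] := @MVT_line (fun s => f (x1, s)) (fun s => f2 (x1, s)) x2 y2
  (fun s => is_derive_vline (d2 _)).
exists (c, y2), (x1, d); rewrite /l1norm/= subrr normr0; split.
- by rewrite lerD2r.
- by rewrite add0r (le_trans dx)// lerDr.
- by rewrite -Ec -Ed; ring.
Qed.

Variable M : R.

Lemma lipschitz_plane (x y : R * R) : (forall z, `|f1 z| <= M) -> (forall z, `|f2 z| <= M) ->
  `|f y - f x| <= M * l1norm (y - x).
Proof.
move=> b1 b2; have [u [w [_ _ ->]]] := MVT_plane x y.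
by rewrite (le_trans (ler_normD _ _))// !normrM mulrDr lerD// ler_wpM2r.
Qed.

(** The mean value points of [MVT_plane] are within [l1norm (y - x)] of [x], so
    replacing them by [x] costs an error of second order. *)
Lemma taylor_plane (x y : R * R) : 0 <= M ->
  (forall z z', `|f1 z' - f1 z| <= M * l1norm (z' - z)) ->
  (forall z z', `|f2 z' - f2 z| <= M * l1norm (z' - z)) ->
  `|f y - f x - (f1 x * (y.1 - x.1) + f2 x * (y.2 - x.2))| <= M * l1norm (y - x) ^+ 2.
Proof.
move=> M0 b1 b2; have [u [w [ux wx ->]]] := MVT_plane x y.
have -> : f1 u * (y.1 - x.1) + f2 w * (y.2 - x.2) -
    (f1 x * (y.1 - x.1) + f2 x * (y.2 - x.2)) =
    (f1 u - f1 x) * (y.1 - x.1) + (f2 w - f2 x) * (y.2 - x.2) by ring.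
rewrite (le_trans (ler_normD _ _))// !normrM expr2 mulrA {2}/l1norm [leRHS]mulrDr.
by rewrite lerD// ler_wpM2r// (le_trans (b1 _ _) _, le_trans (b2 _ _) _)// ler_wpM2l.
Qed.

End taylor.
End plane.

(** * Uniform bounds for a smooth periodic field *)

Section regularity.
Context {R : realType}.

(** The retraction of the line onto the time interval turns continuity on the
    strip into continuity on the whole space. *)
Definition clamp (t : R) : R := Num.max 0 (Num.min 1 t).

Lemma clamp_itv t : 0 <= clamp t <= 1.
Proof. by rewrite /clamp le_max lexx/= ge_max ler01 ge_min lexx. Qed.

Lemma clamp_id t : 0 <= t <= 1 -> clamp t = t.
Proof. by move=> /andP[t0 t1]; rewrite /clamp (min_idPr t1) (max_idPr t0). Qed.

Lemma continuous_clamp : continuous clamp.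
Proof.
move=> t; apply: continuous_max; first exact: cvg_cst.
by apply: continuous_min; [exact: cvg_cst|exact: cvg_id].
Qed.

Lemma floor_part_itv (x : R) : 0 <= x - (Num.floor x)%:~R < 1.
Proof.
by rewrite subr_ge0 floor_le/= ltrBlDl -intrD1 floorD1_gt.
Qed.

Lemma torus_proj_torus (x : R * R) : torus (torus_proj x).
Proof. by split; rewrite /= in_itv/= floor_part_itv. Qed.

Lemma torus_projE (x : R * R) :
  torus_proj x = x - zvec (Num.floor x.1, Num.floor x.2).
Proof. by []. Qed.

Lemma torus_proj_period (x : R * R) : exists k, x = torus_proj x + zvec k.
Proof.
by exists (Num.floor x.1, Num.floor x.2); rewrite torus_projE subrK.
Qed.

Lemma continuous_strip (W : topologicalType) (f : R -> R * R -> W) :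
  {within `[0, 1] `*` [set: R * R], continuous (fun p : R * (R * R) => f p.1 p.2)} ->
  continuous (fun p : R * (R * R) => f (clamp p.1) p.2).
Proof.
move=> /subspace_continuousP cf p.
have cp : `[0, 1]%classic (clamp p.1) by rewrite /= in_itv/= clamp_itv.
have h := cf (clamp p.1, p.2) (conj cp I).
rewrite /continuous_at; apply: cvg_trans h.
apply: (@cvg_comp _ _ _ (fun p : R * (R * R) => (clamp p.1, p.2))
  (fun p : R * (R * R) => f p.1 p.2) (nbhs p)
  (within (`[0, 1] `*` [set: R * R]) (nbhs (clamp p.1, p.2)))) => //.
have cc : (fun p : R * (R * R) => (clamp p.1, p.2)) @ p --> (clamp p.1, p.2).
  have c1 : (clamp q.1) @[q --> p] --> clamp p.1.
    exact: (@continuous_comp _ _ _ fst clamp p (@cvg_fst _ _ _ _ _) (@continuous_clamp p.1)).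
  exact: (cvg_pair c1 (@cvg_snd _ _ _ _ _)).
move=> A hA; have h2 := cc _ hA.
apply: (@filterS _ (nbhs p) _ _ _ _ h2) => q; apply.
by split=> //=; rewrite in_itv; exact: clamp_itv.
Qed.

(** By periodicity the values are those on a compact box. *)
Lemma strip_bounded (f : R -> R * R -> R) :
  continuous (fun p : R * (R * R) => f (clamp p.1) p.2) ->
  (forall t x k, 0 <= t <= 1 -> f t (x + zvec k) = f t x) ->
  exists M, forall t x, 0 <= t <= 1 -> `|f t x| <= M.
Proof.
move=> cf pf.
have cK : compact (`[0, 1]%classic `*` (`[0, 1]%classic `*` `[0, 1]%classic) : set (R * (R * R))).
  by do 2 (apply: compact_setX; first exact: segment_compact); exact: segment_compact.
have /compact_bounded[M [_ bM]] := continuous_compact (continuous_subspaceT cf) cK.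
exists (M + 1) => t x t01; have [k xk] := torus_proj_period x.
rewrite xk pf//; apply: (bM (M + 1)); first by rewrite ltrDl.
exists (t, torus_proj x); last by rewrite /= clamp_id.
split=> /=; first by rewrite in_itv.
by have [/= + +] := torus_proj_torus x; rewrite !in_itv/= =>
  /andP[-> /ltW ->] /andP[-> /ltW ->].
Qed.

Lemma is_derive_period (f : R * R -> R * R) (v x l : R * R) k :
  (forall x, f (x + zvec k) = f x) ->
  is_derive x v f l -> is_derive (x + zvec k) v f l.
Proof.
move=> pf /is_deriveP h; apply/is_deriveP; apply: cvg_trans h; apply: near_eq_cvg.
by near=> u; rewrite pf addrA pf.
Unshelve. all: by end_near. Qed.

Lemma is_derive_unique (V W : normedModType R) (f : V -> W) x v l l' :
  is_derive x v f l -> is_derive x v f l' -> l = l'.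
Proof. by move=> [_ <-] [_ <-]. Qed.

(** What the smoothness of [F] provides for the estimates: its space
    derivatives [G i] are continuous, and bounded and Lipschitz in space uniformly
    in time. *)
Record field_bounds (F : R -> R * R -> R * R)
    (G : 'I_2 -> R -> R * R -> R * R) (M : R) : Prop := FieldBounds {
  field_M_ge0 : 0 <= M ;
  fb_contG : forall i, continuous (fun p : R * (R * R) => G i (clamp p.1) p.2) ;
  fb_perF : forall t x k, 0 <= t <= 1 -> F t (x + zvec k) = F t x ;
  fb_perG : forall i t x k, 0 <= t <= 1 -> G i t (x + zvec k) = G i t x ;
  fb_derive : forall i t x, 0 <= t <= 1 ->
    is_derive x (basis_vec i) (F t) (G i t x) ;
  fb_bound : forall i j t x, 0 <= t <= 1 -> `|coord2 j (G i t x)| <= M ;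
  fb_lip : forall i j t x y, 0 <= t <= 1 ->
    `|coord2 j (G i t y) - coord2 j (G i t x)| <= M * l1norm (y - x) }.

Lemma continuous_coord2 (T : topologicalType) (f : T -> R * R) j :
  continuous f -> continuous (fun t => coord2 j (f t)).
Proof.
move=> cf t; have /cvg_pairP[f1 f2] := cf t.
by rewrite /coord2 /continuous_at; case: ifP.
Qed.

Lemma strip_bounded2 (f : 'I_2 -> 'I_2 -> R -> R * R -> R) :
  (forall i j, continuous (fun p : R * (R * R) => f i j (clamp p.1) p.2)) ->
  (forall i j t x k, 0 <= t <= 1 -> f i j t (x + zvec k) = f i j t x) ->
  exists2 M, 0 <= M & forall i j t x, 0 <= t <= 1 -> `|f i j t x| <= M.
Proof.
move=> cf pf.
have /choice[B hB] : forall ij : 'I_2 * 'I_2, exists M, forall t x, 0 <= t <= 1 ->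
    `|f ij.1 ij.2 t x| <= M.
  by move=> [i j]; apply: strip_bounded => //; exact: pf.
exists (\sum_ij `|B ij|); first by rewrite sumr_ge0.
move=> i j t x t01; rewrite (bigD1 (i, j))//= (le_trans (hB (i, j) t x t01))//.
by rewrite (le_trans (ler_norm _))// lerDl sumr_ge0.
Qed.

(** The second derivatives are periodic and continuous, hence bounded, and their
    bound is a Lipschitz constant of the first ones. *)
Lemma smooth_field_bounds (F : R -> R * R -> R * R) :
  smooth_torus_field F -> exists G M, field_bounds F G M.
Proof.
move=> [/(_ 2%N)[_ [Ft [G [_ dG _ CG]]]] pF].
have pG i t x k : 0 <= t <= 1 -> G i t (x + zvec k) = G i t x.
  move=> t01; apply: is_derive_unique (dG i t _ t01) _.
  by apply: is_derive_period (dG i t x t01) => y; exact: pF.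
have cG i : continuous (fun p : R * (R * R) => G i (clamp p.1) p.2).
  by have [/continuous_strip] := CG i.
have /choice[H hH] : forall i, exists H : 'I_2 -> R -> R * R -> R * R,
    (forall j t x, 0 <= t <= 1 -> is_derive x (basis_vec j) (G i t) (H j t x)) /\
    forall j, continuous (fun p : R * (R * R) => H j (clamp p.1) p.2).
  move=> i; have [_ [_ [H [_ dH _ CH]]]] := CG i; exists H; split=> // j.
  by have [/continuous_strip] := CH j.
have pH i j t x k : 0 <= t <= 1 -> H i j t (x + zvec k) = H i j t x.
  move=> t01; have [dH _] := hH i; apply: is_derive_unique (dH j t _ t01) _.
  by apply: is_derive_period (dH j t x t01) => y; exact: pG.
have [M1 M10 hM1] := @strip_bounded2 (fun i j t x => coord2 j (G i t x))
  (fun i j => continuous_coord2 (cG i)) (fun i j t x k h => congr1 (coord2 j) (pG i t x k h)).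
have hM2 l := @strip_bounded2 (fun i j t x => coord2 l (H i j t x))
  (fun i j => continuous_coord2 ((hH i).2 j))
  (fun i j t x k h => congr1 (coord2 l) (pH i j t x k h)).
have [M2 M20 {}hM2] : exists2 M, 0 <= M & forall l i j t x, 0 <= t <= 1 ->
    `|coord2 l (H i j t x)| <= M.
  have [A A0 hA] := hM2 ord0; have [B B0 hB] := hM2 ord_max.
  exists (A + B); first by rewrite addr_ge0.
  move=> l i j t x t01; have := hA i j t x t01; have := hB i j t x t01.
  by rewrite /coord2/=; case: ifP => _; lra.
exists G, (M1 + M2); split=> //.
- by rewrite addr_ge0.
- by move=> i j t x t01; rewrite (le_trans (hM1 i j t x t01))//; lra.
- move=> i j t x y t01.
  apply: (@le_trans _ _ (M2 * l1norm (y - x))); last by rewrite ler_wpM2r ?l1norm_ge0//; lra.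
  apply: (@lipschitz_plane _ (fun x => coord2 j (G i t x))
    (fun x => coord2 j (H i ord0 t x)) (fun x => coord2 j (H i ord_max t x))).
  + by move=> z; apply: is_derive_coord2; exact: ((hH i).1 ord0 t z t01).
  + by move=> z; apply: is_derive_coord2; exact: ((hH i).1 ord_max t z t01).
  + by move=> z; exact: hM2.
  + by move=> z; exact: hM2.
Qed.

Section consequences.
Variables (F : R -> R * R -> R * R) (G : 'I_2 -> R -> R * R -> R * R) (M : R).
Hypothesis FG : field_bounds F G M.

(** The [j]-th component of the derivative of [F t] at [x] applied to [v]. *)
Definition dirderiv t (x v : R * R) (j : 'I_2) : R :=
  coord2 j (G ord0 t x) * v.1 + coord2 j (G ord_max t x) * v.2.

Lemma jac_field t x i j : 0 <= t <= 1 -> jac (F t) x i j = coord2 j (G i t x).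
Proof.
move=> t01; rewrite mxE.
by have [_ ->] := is_derive_coord2 j (fb_derive FG i x t01).
Qed.

Lemma field_lipschitz j t x y : 0 <= t <= 1 ->
  `|coord2 j (F t y) - coord2 j (F t x)| <= M * l1norm (y - x).
Proof.
move=> t01; apply: (@lipschitz_plane _ (fun x => coord2 j (F t x))
    (fun x => coord2 j (G ord0 t x)) (fun x => coord2 j (G ord_max t x))) => z.
- by apply: is_derive_coord2; exact: (fb_derive FG ord0).
- by apply: is_derive_coord2; exact: (fb_derive FG ord_max).
- exact: (fb_bound FG).
- exact: (fb_bound FG).
Qed.

Lemma field_taylor j t x y : 0 <= t <= 1 ->
  `|coord2 j (F t y) - coord2 j (F t x) - dirderiv t x (y - x) j| <= M * l1norm (y - x) ^+ 2.
Proof.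
move=> t01; apply: (@taylor_plane _ (fun x => coord2 j (F t x))
    (fun x => coord2 j (G ord0 t x)) (fun x => coord2 j (G ord_max t x))).
- by move=> z; apply: is_derive_coord2; exact: (fb_derive FG ord0).
- by move=> z; apply: is_derive_coord2; exact: (fb_derive FG ord_max).
- exact: (field_M_ge0 FG).
- by move=> z z'; exact: (fb_lip FG).
- by move=> z z'; exact: (fb_lip FG).
Qed.

Lemma dirderiv_bound j t x v : 0 <= t <= 1 -> `|dirderiv t x v j| <= M * l1norm v.
Proof.
move=> t01; rewrite (le_trans (ler_normD _ _))// !normrM mulrDr.
by rewrite lerD// ler_wpM2r// (fb_bound FG).
Qed.

End consequences.
End regularity.

(** * Gronwall's inequality and energy estimates *)

Section gronwall.
Context {R : realType}.

Lemma within_exp (P : R -> R) (A : set R) :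
  {within A, continuous P} -> {within A, continuous (fun t => expR (P t))}.
Proof.
by move=> cP t; apply: continuous_comp; [exact: cP|exact: continuous_expR].
Qed.

(** The function [f * exp (- P)] is nonincreasing. *)
Lemma gronwall (f df P A : R -> R) :
  {within `[0, 1], continuous f} -> {within `[0, 1], continuous P} ->
  (forall t : R, 0 < t < 1 -> is_derive t 1 f (df t)) ->
  (forall t : R, 0 < t < 1 -> is_derive t 1 P (A t)) ->
  (forall t : R, 0 < t < 1 -> df t <= A t * f t) ->
  forall t : R, 0 <= t <= 1 -> f t <= f 0 * expR (P t - P 0).
Proof.
move=> cf cP dfE dPE dfA t /andP[t0 t1].
pose g s := f s * expR (- P s).
have dg (s : R) : 0 < s < 1 -> is_derive s 1 g
    (f s *: (expR (- P s) *: - A s) + expR (- P s) *: df s).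
  move=> s01; have := dfE s s01; have := dPE s s01 => ? ?.
  by apply: is_deriveM.
have cg : {within `[0, 1], continuous g}.
  move=> s; apply: cvgM; first exact: cf.
  by apply: (@within_exp (fun s => - P s)) => u; apply: cvgN; exact: cP.
have : g t <= g 0.
  apply: (@ler0_derive1_nincr _ g 0 1) => // [s|s]; rewrite in_itv/= => s01.
    by case: (dg s s01).
  rewrite derive1E; have [_ ->] := dg s s01.
  rewrite /GRing.scale/= mulrCA -mulrDr mulr_ge0_le0 ?expR_ge0//.
  by have := dfA s s01; lra.
rewrite /g -ler_pdivlMr ?expR_gt0// => /le_trans; apply.
by rewrite -mulrA -expRN opprK -expRD addrC.
Qed.

(** Continuity up to the end points with a derivative in the interior is the
    form in which the mean value theorem applies to trajectories. *)
Definition path_deriv (W dW : R -> R * R) :=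
  {within `[0, 1], continuous W} /\
  forall t : R, 0 < t < 1 -> is_derive t 1 W (dW t).

Lemma path_derivB W V dW dV : path_deriv W dW -> path_deriv V dV ->
  path_deriv (fun t => W t - V t) (fun t => dW t - dV t).
Proof.
move=> [cW W'] [cV V']; split=> [t|t t01]; first by apply: cvgB; [exact: cW|exact: cV].
by have := W' t t01; have := V' t t01 => ? ?; exact: is_deriveB.
Qed.

Lemma path_derivZ k W dW : path_deriv W dW ->
  path_deriv (fun t => k *: W t) (fun t => k *: dW t).
Proof.
move=> [cW W']; split=> [t|t t01]; first by apply: cvgZr; exact: cW.
by have := W' t t01 => ?; exact: is_deriveZ.
Qed.

Lemma path_deriv_shift W dW a : path_deriv W dW ->
  path_deriv (fun t => W t + a) dW.
Proof.
move=> [cW W']; split=> [t|t t01].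
  by apply: cvgD; [exact: cW|exact: cvg_cst].
have := W' t t01 => ?.
have := is_deriveD (W' t t01) (is_derive_cst a t 1).
by rewrite addr0.
Qed.

Definition dot (v w : R * R) : R := v.1 * w.1 + v.2 * w.2.

Lemma dot_le_l1norm (v w : R * R) C : 0 <= C -> `|w.1| <= C -> `|w.2| <= C ->
  `|dot v w| <= C * l1norm v.
Proof.
move=> C0 w1 w2; rewrite (le_trans (ler_normD _ _))// !normrM mulrC [X in _ + X]mulrC.
by rewrite mulrDr lerD// ler_wpM2r.
Qed.

Lemma dot_le_field (v w : R * R) M : 0 <= M -> `|w.1| <= M * l1norm v -> `|w.2| <= M * l1norm v ->
  `|dot v w| <= 2 * M * sqn v.
Proof.
move=> M0 w1 w2; have := @dot_le_l1norm v w (M * l1norm v) (mulr_ge0 M0 (l1norm_ge0 v)) w1 w2.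
move/le_trans; apply; rewrite -mulrA -expr2 [2 * M]mulrC -mulrA ler_wpM2l//.
exact: l1norm_le_sqn.
Qed.

Section energy.
Variables (W dW : R -> R * R).
Hypothesis WdW : path_deriv W dW.

Lemma within_sqn : {within `[0, 1], continuous (fun t => sqn (W t))}.
Proof.
have [cW _] := WdW; move=> t; have /cvg_pairP[c1 c2] := cW t.
by apply: cvgD; rewrite /continuous_at !expr2; exact: cvgM.
Qed.

Lemma is_derive_sqn (t : R) : 0 < t < 1 ->
  is_derive t 1 (fun t => sqn (W t)) (2 * dot (W t) (dW t)).
Proof.
move=> t01; have [_ /(_ t t01) d] := WdW.
have d1 := is_derive_fst d; have d2 := is_derive_snd d.
have := is_deriveD (is_deriveM d1 d1) (is_deriveM d2 d2).
rewrite /sqn; move=> /is_derive_eq; apply.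
by rewrite /dot /GRing.scale/=; ring.
Qed.

Variables (P A : R -> R).
Hypothesis cP : {within `[0, 1], continuous P}.
Hypothesis dP : forall t : R, 0 < t < 1 -> is_derive t 1 P (A t).

(** The constant [b] absorbs an inhomogeneous term in the equation of [W]. *)
Lemma energy_upper b :
  (forall t : R, 0 < t < 1 -> 2 * dot (W t) (dW t) <= A t * (sqn (W t) + b)) ->
  forall t : R, 0 <= t <= 1 -> sqn (W t) + b <= (sqn (W 0) + b) * expR (P t - P 0).
Proof.
move=> h t t01.
apply: (@gronwall (fun t => sqn (W t) + b) (fun t => 2 * dot (W t) (dW t)) P A) => //.
- by move=> s; apply: cvgD; [exact: within_sqn|exact: cvg_cst].
- move=> s s01.
  have := is_deriveD (is_derive_sqn s01) (is_derive_cst b s 1).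
  by rewrite addr0.
Qed.

Lemma energy_lower :
  (forall t : R, 0 < t < 1 -> A t * sqn (W t) <= 2 * dot (W t) (dW t)) ->
  forall t : R, 0 <= t <= 1 -> sqn (W 0) * expR (P t - P 0) <= sqn (W t).
Proof.
move=> h t t01; rewrite -lerN2 -mulNr.
apply: (@gronwall (fun t => - sqn (W t)) (fun t => - (2 * dot (W t) (dW t))) P A) => //.
- by move=> s; apply: cvgN; exact: within_sqn.
- by move=> s s01; have := is_derive_sqn s01 => ?; apply: is_deriveN.
- by move=> s s01; rewrite mulrN lerN2 h.
Qed.

End energy.

Lemma within_linear (c : R) (A : set R) : {within A, continuous (fun t => c * t)}.
Proof.
by apply: continuous_subspaceT => t; apply: cvgMr; exact: cvg_id.
Qed.

Lemma is_derive_linear (c t : R) : is_derive t 1 (fun t => c * t) c.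
Proof.
have := @is_deriveZ _ _ _ id c t 1 1 (is_derive_id t 1).
by rewrite /GRing.scale/= mulr1.
Qed.

End gronwall.

(** * Trajectories of the field *)

Section flow.
Context {R : realType}.
Variables (F : R -> R * R -> R * R) (G : 'I_2 -> R -> R * R -> R * R) (M : R).
Hypothesis FG : field_bounds F G M.

Definition solution (u : R -> R * R) := path_deriv u (fun t => F t (u t)).

(** Trajectories move apart or together by at most this factor in Euclidean
    norm. *)
Definition flow_lip : R := expR (2 * M).

Lemma flow_lip_ge1 : 1 <= flow_lip.
Proof. by rewrite /flow_lip -expR0 ler_expR mulr_ge0// (field_M_ge0 FG). Qed.

Lemma flow_lip_ge0 : 0 <= flow_lip.
Proof. exact: expR_ge0. Qed.

Lemma itvoo_cc (t : R) : 0 < t < 1 -> 0 <= t <= 1.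
Proof. by move=> /andP[/ltW -> /ltW ->]. Qed.

Lemma solution_dot u v t : 0 < t < 1 ->
  `|dot (u t - v t) (F t (u t) - F t (v t))| <= 2 * M * sqn (u t - v t).
Proof.
move=> /itvoo_cc t01; apply: dot_le_field; first exact: (field_M_ge0 FG).
- exact: (field_lipschitz FG ord0 _ _ t01).
- exact: (field_lipschitz FG ord_max _ _ t01).
Qed.

Lemma solution_lip_upper u v : solution u -> solution v ->
  forall t : R, 0 <= t <= 1 -> sqn (u t - v t) <= flow_lip ^+ 2 * sqn (u 0 - v 0).
Proof.
move=> su sv t t01.
have h := @energy_upper _ _ _ (path_derivB su sv) (fun t => 4 * M * t) (fun=> 4 * M)
  (@within_linear _ _ _) (fun t _ => is_derive_linear _ _) 0.
have {h} := h _ t t01; rewrite !addr0 mulr0 subr0 => h.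
apply: le_trans (h _) _ => [s s01|].
  by have := solution_dot u v s01; rewrite addr0 ler_norml => /andP[_]; lra.
rewrite [leRHS]mulrC ler_wpM2l ?sqn_ge0// /flow_lip -expRM_natl ler_expR.
by have := field_M_ge0 FG => M0; move: t01 => /andP[_ t1]; nra.
Qed.

Lemma solution_lip_lower u v : solution u -> solution v ->
  forall t : R, 0 <= t <= 1 -> sqn (u 0 - v 0) <= flow_lip ^+ 2 * sqn (u t - v t).
Proof.
move=> su sv t t01.
have h := @energy_lower _ _ _ (path_derivB su sv) (fun t => - (4 * M) * t) (fun=> - (4 * M))
  (@within_linear _ _ _) (fun t _ => is_derive_linear _ _).
have {h} := h _ t t01; rewrite mulr0 subr0 => h.
rewrite mulrC -ler_pdivrMr ?exprn_gt0 ?expR_gt0//; apply: le_trans (h _) => [|s s01].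
  rewrite ler_wpM2l ?sqn_ge0// /flow_lip -expRM_natl -expRN ler_expR.
  by have := field_M_ge0 FG => M0; move: t01 => /andP[_ t1]; nra.
by have := solution_dot u v s01; rewrite ler_norml => /andP[]; lra.
Qed.

Lemma solution_l1norm_upper u v : solution u -> solution v ->
  forall t : R, 0 <= t <= 1 -> l1norm (u t - v t) <= 2 * flow_lip * l1norm (u 0 - v 0).
Proof.
move=> su sv t t01; apply: l1norm_le_of_sqn; first exact: flow_lip_ge0.
exact: solution_lip_upper.
Qed.

Lemma solution_l1norm_lower u v : solution u -> solution v ->
  forall t : R, 0 <= t <= 1 -> l1norm (u 0 - v 0) <= 2 * flow_lip * l1norm (u t - v t).
Proof.
move=> su sv t t01; apply: l1norm_le_of_sqn; first exact: flow_lip_ge0.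
exact: solution_lip_lower.
Qed.

End flow.

Section lifted_flow.
Context {R : realType}.

Lemma is_time_derive_cvg (f : R -> R * R) (t : R) l :
  is_time_derive f t l -> f @ within `[0, 1] (nbhs t) --> f t.
Proof.
move=> h.
have h1 : (s - t) *: ((s - t)^-1 *: (f s - f t)) @[s --> within `[0, 1] t^'] --> (0 : R * R).
  rewrite -(scale0r l); apply: cvgZ; last exact: h.
  have h0 : s - t @[s --> t] --> t - t by apply: cvgB; [exact: cvg_id|exact: cvg_cst].
  by rewrite subrr in h0; do 2 apply: cvg_within_filter.
have h2 : f @ within `[0, 1] t^' --> f t.
  have h3 : f t + (s - t) *: ((s - t)^-1 *: (f s - f t)) @[s --> within `[0, 1] t^'] --> f t + 0.
    by apply: cvgD; [exact: cvg_cst|exact: h1].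
  rewrite addr0 in h3; apply: cvg_trans h3.
  apply: near_eq_cvg; near=> s.
  have st : s != t by near: s; exact: (@cvg_within _ t^' _ `[0, 1]%classic _ (nbhs_dnbhs_neq t)).
  by rewrite scalerA divff ?subr_eq0// scale1r addrC subrK.
move=> A hA; have := h2 _ hA; rewrite /within/= => h4.
apply: (@filterS _ (nbhs t) _ _ _ _ h4) => s hs Ds.
by have [->|st] := eqVneq s t; [exact: (nbhs_singleton hA)|exact: hs].
Unshelve. all: by end_near. Qed.

Lemma is_time_derive_interior (f : R -> R * R) (t : R) l : 0 < t < 1 ->
  is_time_derive f t l -> is_derive t 1 f l.
Proof.
move=> /andP[t0 t1] h; apply/is_deriveP.
have h1 : (h : R) + t @[h --> 0^'] --> within `[0, 1] t^'.
  move=> A; rewrite /within/= => hA.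
  have c : (h : R) + t @[h --> (0 : R)] --> 0 + t.
    by apply: cvgD; [exact: cvg_id|exact: cvg_cst].
  rewrite add0r in c; have h2 := c _ hA.
  have t01 : t \in `]0, 1[%R by rewrite in_itv/= t0.
  have h3 := c _ (near_in_itvoo t01).
  apply: (@filterS2 _ (nbhs (0 : R)) _ _ _ _ _ h2 h3) => u h2u h3u u0; apply: h2u.
    by rewrite -subr_eq0 addrK.
  by move: h3u; rewrite /= !in_itv/= => /itvoo_cc.
have := cvg_comp _ _ h1 h; apply: cvg_trans; apply: near_eq_cvg.
by near=> u; rewrite /= /GRing.scale/= mulr1 addrK.
Unshelve. all: by end_near. Qed.

Lemma lifted_flow_path (F Phi : R -> R * R -> R * R) x :
  is_lifted_flow F Phi -> path_deriv (Phi ^~ x) (fun t => F t (Phi t x)).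
Proof.
move=> [_ h]; split=> [|t t01].
  apply/subspace_continuousP => t; rewrite /= in_itv/= => t01.
  exact: is_time_derive_cvg (h t x t01).
apply: is_time_derive_interior => //; apply: h; exact: itvoo_cc.
Qed.

End lifted_flow.

(** * The flow map: Lipschitz bounds, periodicity, bijectivity *)

Section plane_norm.
Context {R : realType}.
Implicit Types v w : R * R.

Lemma l1normN v : l1norm (- v) = l1norm v.
Proof. by rewrite /l1norm/= !normrN. Qed.

Lemma l1normB v w : l1norm (v - w) = l1norm (w - v).
Proof. by rewrite -l1normN opprB. Qed.

Lemma l1normD v w : l1norm (v + w) <= l1norm v + l1norm w.
Proof. by rewrite /l1norm/= [leRHS]addrACA lerD ?ler_normD. Qed.

Lemma l1norm_eq0 v : l1norm v <= 0 -> v = 0.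
Proof.
case: v => a b; rewrite /l1norm/= => h.
have a0 : `|a| <= 0 by rewrite (le_trans _ h)// lerDl.
have b0 : `|b| <= 0 by rewrite (le_trans _ h)// lerDr.
by move: a0 b0; rewrite !normr_le0 => /eqP -> /eqP ->.
Qed.

Lemma coord1_l1norm v : `|v.1| <= l1norm v.
Proof. by rewrite lerDl. Qed.

Lemma coord2_l1norm v : `|v.2| <= l1norm v.
Proof. by rewrite lerDr. Qed.

Lemma norm_le_l1norm v : `|v| <= l1norm v.
Proof. by rewrite prod_normE/= ge_max coord1_l1norm coord2_l1norm. Qed.

Lemma l1norm_le_norm v : l1norm v <= 2 * `|v|.
Proof. by rewrite prod_normE mulr_natl mulr2n lerD// le_max lexx ?orbT. Qed.

Lemma l1norm_lipschitz_continuous (f : R * R -> R * R) C :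
  (forall x y, l1norm (f x - f y) <= C * l1norm (x - y)) -> continuous f.
Proof.
move=> fC x; apply/cvgrPdist_lt => e e0.
have C1 : 0 < `|C| + 1 by rewrite ltr_wpDl.
near=> y; apply: (le_lt_trans (norm_le_l1norm _)); apply: (le_lt_trans (fC _ _)).
apply: (@le_lt_trans _ _ ((`|C| + 1) * (2 * `|x - y|))).
  apply: (@le_trans _ _ ((`|C| + 1) * l1norm (x - y))).
    by rewrite ler_wpM2r ?l1norm_ge0// (le_trans (ler_norm C))// lerDl.
  by apply: ler_wpM2l; [exact: ltW|exact: l1norm_le_norm].
rewrite -ltr_pdivlMl// -ltr_pdivlMl//; near: y; apply: cvgr_dist_lt => //.
by rewrite !mulr_gt0 ?invr_gt0.
Unshelve. all: by end_near. Qed.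

Lemma continuous_l1norm : continuous (@l1norm R).
Proof.
move=> x; have /cvg_pairP[a b] : (fun v : R * R => v) @ x --> x by exact: cvg_id.
by apply: cvgD; exact: cvg_norm.
Qed.

Lemma compact_box (B : R) : compact (`[- B, B]%classic `*` `[- B, B]%classic).
Proof. by apply: compact_setX; exact: segment_compact. Qed.

End plane_norm.

Section flow_map.
Context {R : realType}.
Variables (F Phi : R -> R * R -> R * R).
Variables (G : 'I_2 -> R -> R * R -> R * R) (M : R).
Hypothesis FG : field_bounds F G M.
Hypothesis flow : is_lifted_flow F Phi.

Local Notation K := (flow_lip M).

Lemma flow0 x : Phi 0 x = x.
Proof. by case: flow. Qed.

Lemma flow_solution x : solution F (Phi ^~ x).
Proof. exact: lifted_flow_path. Qed.

Lemma flow_l1norm_upper t x y : 0 <= t <= 1 ->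
  l1norm (Phi t x - Phi t y) <= 2 * K * l1norm (x - y).
Proof.
move=> t01; rewrite -{2}(flow0 x) -{2}(flow0 y).
exact: (solution_l1norm_upper FG (flow_solution x) (flow_solution y)).
Qed.

Lemma flow_l1norm_lower t x y : 0 <= t <= 1 ->
  l1norm (x - y) <= 2 * K * l1norm (Phi t x - Phi t y).
Proof.
move=> t01; rewrite -{1}(flow0 x) -{1}(flow0 y).
exact: (solution_l1norm_lower FG (flow_solution x) (flow_solution y)).
Qed.

Lemma flow_continuous t : 0 <= t <= 1 -> continuous (Phi t).
Proof. by move=> t01; apply: l1norm_lipschitz_continuous => x y; exact: flow_l1norm_upper. Qed.

Lemma flow_inj t : 0 <= t <= 1 -> injective (Phi t).
Proof.
move=> t01 x y xy; apply/subr0_eq/l1norm_eq0/(le_trans (flow_l1norm_lower _ _ t01)).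
by rewrite xy subrr /l1norm/= normr0 addr0 mulr0.
Qed.

(** By uniqueness, since the translate of a trajectory by an integer vector is a
    trajectory. *)
Lemma flow_period t x k : 0 <= t <= 1 -> Phi t (x + zvec k) = Phi t x + zvec k.
Proof.
move=> t01; apply/subr0_eq/l1norm_eq0.
have s1 := flow_solution (x + zvec k).
have s2 : solution F (fun t => Phi t x + zvec k).
  have [c d] := path_deriv_shift (zvec k) (flow_solution x); split=> // s s01.
  by rewrite (fb_perF FG) ?itvoo_cc//; exact: d.
apply: (le_trans (solution_l1norm_upper FG s1 s2 t01)).
by rewrite !flow0 subrr /l1norm/= normr0 addr0 mulr0.
Qed.

(** This makes [Phi t] a small Lipschitz perturbation of [Phi s], through which
    surjectivity propagates. *)
Lemma flow_increment s t x y : 0 <= s -> s <= t -> t <= 1 ->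
  l1norm ((Phi t x - Phi s x) - (Phi t y - Phi s y)) <= (t - s) * (4 * M * K * l1norm (x - y)).
Proof.
move=> s0 st t1.
have [cW dW] := path_derivB (flow_solution x) (flow_solution y).
have sub : `[s, t]%classic `<=` `[0, 1]%classic.
  by apply: subset_itv; rewrite bnd_simp.
have bnd (j : 'I_2) : `|(coord2 j (Phi t x - Phi t y)) - (coord2 j (Phi s x - Phi s y))|
    <= (t - s) * (2 * M * K * l1norm (x - y)).
  have d (u : R) : u \in `]s, t[%R -> is_derive u 1
      (fun u => coord2 j (Phi u x - Phi u y)) (coord2 j (F u (Phi u x) - F u (Phi u y))).
    rewrite in_itv/= => /andP[su ut]; apply: is_derive_coord2; apply: dW.
    by rewrite (le_lt_trans s0 su) (lt_le_trans ut t1).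
  have c : {within `[s, t], continuous (fun u => coord2 j (Phi u x - Phi u y))}.
    apply: continuous_subspaceW sub _; exact: (continuous_coord2 cW).
  have [c0] := MVT_segment st d c.
  rewrite in_itv/= => /andP[sc ct] ->.
  have c01 : 0 <= c0 <= 1 by rewrite (le_trans s0 sc) (le_trans ct t1).
  rewrite normrM mulrC (ger0_norm (_ : 0 <= t - s)) ?subr_ge0// ler_wpM2l ?subr_ge0//.
  have := field_lipschitz FG j (Phi c0 y) (Phi c0 x) c01.
  have -> : coord2 j (F c0 (Phi c0 x) - F c0 (Phi c0 y)) =
    coord2 j (F c0 (Phi c0 x)) - coord2 j (F c0 (Phi c0 y)).
    by rewrite /coord2; case: ifP.
  move/le_trans; apply.
  rewrite [2 * M]mulrC -2!mulrA ler_wpM2l ?(field_M_ge0 FG)// mulrA.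
  exact: flow_l1norm_upper.
have E (a b c d : R * R) : a - b - (c - d) = a - c - (b - d).
  by rewrite !opprD !opprK addrACA.
rewrite E; apply: le_trans (lerD (bnd ord0) (bnd ord_max)) _.
by rewrite -mulrDr -mulrDl ler_wpM2l ?subr_ge0//; lra.
Qed.

(** Let [x0] minimise the distance from [Phi t x] to [z]. Correcting the error at
    time [s], with [x1] such that [Phi s x1 = Phi s x0 + (z - Phi t x0)], divides
    the distance by two because [Phi t - Phi s] varies little; so the minimal
    distance is zero. *)
Lemma flow_surj_step s t : 0 <= s -> s <= t -> t <= 1 ->
  (t - s) * (16 * M * K ^+ 2) <= 1 ->
  (forall z, exists x, Phi s x = z) -> forall z, exists x, Phi t x = z.
Proof.
move=> s0 st t1 small surj z.
have s01 : 0 <= s <= 1 by rewrite s0 (le_trans st).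
have t01 : 0 <= t <= 1 by rewrite t1 (le_trans s0).
pose phi x := l1norm (Phi t x - z).
have cphi : continuous phi.
  move=> x; apply: (@continuous_comp _ _ _ (fun x => Phi t x - z) (@l1norm R)).
    by apply: cvgB; [exact: flow_continuous|exact: cvg_cst].
  exact: continuous_l1norm.
(* Outside the box of radius [B], the image is farther from [z] than [Phi t 0] is. *)
pose B := 4 * K * phi 0.
have inB x : phi x <= phi 0 -> (`[- B, B]%classic `*` `[- B, B]%classic) x.
  move=> h; have : l1norm x <= B.
    rewrite -{1}(subr0 x); apply: (le_trans (flow_l1norm_lower _ _ t01)).
    rewrite /B -mulrA -[4 * K * _]mulrA; have := flow_lip_ge1 FG.
    have := l1normD (Phi t x - z) (z - Phi t 0).
    rewrite addrA subrK (l1normB z) => h1 K1.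
    have : K * l1norm (Phi t x - Phi t 0) <= K * (2 * phi 0).
      by rewrite ler_wpM2l ?flow_lip_ge0//; move: h h1; rewrite /phi; lra.
    lra.
  move=> xB; have := coord1_l1norm x; have := coord2_l1norm x.
  by rewrite !ler_norml => /andP[a b] /andP[c d]; split; rewrite /= in_itv/=; apply/andP; split; lra.
have [x0 _ x0min] := @compact_EVT_min _ R phi _ (ex_intro _ 0 (inB 0 (lexx _)))
  (@compact_box R B) (continuous_subspaceT cphi).
have min0 : phi x0 <= phi 0 by apply: x0min; rewrite inE; exact: inB.
have [x1 x1E] := surj (z - Phi t x0 + Phi s x0).
have h1 : phi x1 <= phi x0 / 2.
  rewrite {1}/phi; have -> : Phi t x1 - z = (Phi t x1 - Phi s x1) - (Phi t x0 - Phi s x0).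
    by rewrite x1E; rewrite /GRing.add/= /GRing.opp/=; congr pair; rewrite /=; ring.
  apply: (le_trans (flow_increment _ _ s0 st t1)).
  have h2 := flow_l1norm_lower x1 x0 s01.
  rewrite x1E addrK l1normB -/(phi x0) in h2.
  have := flow_lip_ge1 FG; have := field_M_ge0 FG => M0 K1.
  have p0 : 0 <= phi x0 by exact: l1norm_ge0.
  apply: (@le_trans _ _ ((t - s) * (4 * M * K * (2 * K * phi x0)))).
    by rewrite ler_wpM2l ?subr_ge0// ler_wpM2l// !mulr_ge0//; lra.
  have := ler_wpM2r p0 small; lra.
have h3 : phi x0 <= phi x1.
  by apply: x0min; rewrite inE; apply: inB; move: h1 min0 (l1norm_ge0 (Phi t x0 - z)); rewrite -/(phi x0); lra.
exists x0; apply/subr0_eq/l1norm_eq0; rewrite -/(phi x0).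
by have := l1norm_ge0 (Phi t x0 - z); rewrite -/(phi x0); lra.
Qed.

(** The interval [[0, t]] is divided into steps short enough for
    [flow_surj_step]. *)
Lemma flow_surj t z : 0 <= t <= 1 -> exists x, Phi t x = z.
Proof.
move=> /andP[t0 t1].
pose n := (Num.truncn (16 * M * K ^+ 2)).+1.
have nM : 16 * M * K ^+ 2 <= n%:R by rewrite ltW// truncnS_gt.
have n0 : 0 < n%:R :> R by rewrite ltr0n.
suff h i : (i <= n)%N -> forall z, exists x, Phi (t * (i%:R / n%:R)) x = z.
  by have := h n (leqnn n) z; rewrite divff ?gt_eqF// mulr1.
elim: i => [_ y|i IH lin]; first by exists y; rewrite mul0r mulr0 flow0.
apply: (flow_surj_step _ _ _ _ (IH (ltnW lin))).
- by rewrite !mulr_ge0// ?invr_ge0 ?ler0n.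
- by rewrite ler_wpM2l// ler_wpM2r ?invr_ge0// ler_nat.
- apply: mulr_ile1 => //.
  by rewrite ler_pdivrMr// mul1r ler_nat.
- rewrite -mulrBr -mulrBl -natrB ?leqnSn// subSnn mul1r.
  have X0 : 0 <= 16 * M * K ^+ 2.
    have M0 := field_M_ge0 FG; apply: mulr_ge0; last exact: sqr_ge0.
    by apply: mulr_ge0.
  apply: (@le_trans _ _ (n%:R^-1 * (16 * M * K ^+ 2))).
    by rewrite ler_wpM2r// ler_piMl// invr_ge0 ler0n.
  by rewrite ler_pdivrMl// mulr1.
Qed.

End flow_map.

(** * Stretching along trajectories *)

Section strain.
Context {R : realType}.
Variables (F Phi : R -> R * R -> R * R).
Variables (G : 'I_2 -> R -> R * R -> R * R) (M : R).
Hypothesis FG : field_bounds F G M.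
Hypothesis flow : is_lifted_flow F Phi.

Local Notation K := (flow_lip M).

Definition strain (t : R) (x : R * R) : R := frobenius (jac (F t) x).

Lemma strainE t x : 0 <= t <= 1 -> strain t x =
  Num.sqrt (sqn (G ord0 t x) + sqn (G ord_max t x)).
Proof.
move=> t01; rewrite /strain /frobenius big_ord_recl big_ord1.
rewrite !big_ord_recl !big_ord0 !(jac_field FG)//.
rewrite (_ : lift ord0 ord0 = ord_max); last exact/val_inj.
by rewrite /sqn /coord2/= !addr0.
Qed.

Lemma strain_ge0 t x : 0 <= strain t x.
Proof. exact: sqrtr_ge0. Qed.

Lemma continuous_sqn : continuous (@sqn R).
Proof.
move=> x; have /cvg_pairP[a b] : (fun v : R * R => v) @ x --> x by exact: cvg_id.
by apply: cvgD; rewrite /continuous_at !expr2; exact: cvgM.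
Qed.

Lemma continuous_strain :
  continuous (fun p : R * (R * R) => strain (clamp p.1) p.2).
Proof.
rewrite (_ : (fun _ => _) = fun p => Num.sqrt
  (sqn (G ord0 (clamp p.1) p.2) + sqn (G ord_max (clamp p.1) p.2))); last first.
  by apply/funext => p; rewrite strainE// clamp_itv.
move=> p; apply: (@continuous_comp _ _ _ (fun p : R * (R * R) => sqn _ + sqn _) Num.sqrt);
  last exact: sqrt_continuous.
by apply: cvgD; apply: (@continuous_comp _ _ _ (fun p : R * (R * R) => G _ (clamp p.1) p.2) (@sqn R));
  [exact: (fb_contG FG)|exact: continuous_sqn|exact: (fb_contG FG)|exact: continuous_sqn].
Qed.

Lemma strain_period t x k : 0 <= t <= 1 -> strain t (x + zvec k) = strain t x.
Proof. by move=> t01; rewrite !strainE// !(fb_perG FG). Qed.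

(** The quadratic form of a matrix is bounded by its Frobenius norm. *)
Lemma strain_dot t x (v : R * R) : 0 <= t <= 1 ->
  `|dot v (dirderiv G t x v ord0, dirderiv G t x v ord_max)| <= strain t x * sqn v.
Proof.
move=> t01; rewrite -ler_sqr ?nnegrE ?mulr_ge0 ?strain_ge0 ?sqn_ge0//.
rewrite exprMn strainE// sqr_sqrtr; last by rewrite addr_ge0 ?sqn_ge0.
rewrite real_normK ?num_real//.
rewrite /dot /dirderiv /coord2/= /sqn.
set a := (G ord0 t x).1; set b := (G ord0 t x).2.
set c := (G ord_max t x).1; set d := (G ord_max t x).2.
move: v.1 v.2 => p q.
(* Lagrange's identity: the two sides differ by a sum of squares. *)
rewrite -subr_ge0 (_ : _ - _ = (a * p * q - b * p ^+ 2) ^+ 2 + (a * p * q - c * p ^+ 2) ^+ 2 +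
  (a * q ^+ 2 - d * p ^+ 2) ^+ 2 + (b * p * q - c * p * q) ^+ 2 +
  (b * q ^+ 2 - d * p * q) ^+ 2 + (c * q ^+ 2 - d * p * q) ^+ 2); last by ring.
by rewrite !addr_ge0// sqr_ge0.
Qed.

(** The remainder of the first order expansion of [F t] is quadratic in the
    difference of the trajectories; one factor is bounded through the Lipschitz
    estimate of the flow, which leaves a rate close to [2 * strain]. *)
Lemma stretch_rate t x y : 0 < t < 1 ->
  2 * dot (Phi t y - Phi t x) (F t (Phi t y) - F t (Phi t x)) <=
  (2 * strain t (Phi t x) + 8 * M * K * l1norm (y - x)) * sqn (Phi t y - Phi t x).
Proof.
move=> /itvoo_cc t01; set W := Phi t y - Phi t x; set X := Phi t x.
have M0 := field_M_ge0 FG.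
have h1 := strain_dot X W t01.
pose D : R * R := (dirderiv G t X W ord0, dirderiv G t X W ord_max).
pose r := F t (Phi t y) - F t X - D.
have hr : `|dot W r| <= M * l1norm W ^+ 2 * l1norm W.
  apply: dot_le_l1norm; first by rewrite mulr_ge0 ?sqr_ge0.
    exact: (field_taylor FG ord0 X (Phi t y) t01).
  exact: (field_taylor FG ord_max X (Phi t y) t01).
have -> : F t (Phi t y) - F t X = D + r by rewrite /r [RHS]addrC subrK.
have -> : dot W (D + r) = dot W D + dot W r by rewrite /dot/=; ring.
have W1 : l1norm W <= 2 * K * l1norm (y - x) by exact: (flow_l1norm_upper FG flow).
have h2 : M * l1norm W ^+ 2 * l1norm W <= M * (2 * sqn W) * (2 * K * l1norm (y - x)).
  apply: ler_pM => //; rewrite ?mulr_ge0 ?sqr_ge0 ?l1norm_ge0//.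
  by rewrite ler_wpM2l// l1norm_le_sqn.
move: h1 hr; rewrite -/D !ler_norml => /andP[_ h1] /andP[_ hr]; lra.
Qed.

Definition strain_along (x : R * R) (t : R) : R :=
  strain (clamp t) (Phi (clamp t) x).

Lemma continuous_flow_time x : continuous (fun t : R => Phi (clamp t) x).
Proof.
have [/subspace_continuousP c _] := flow_solution flow x.
move=> t; have ct : `[0, 1]%classic (clamp t) by rewrite /= in_itv; exact: clamp_itv.
have c1 := c _ ct; rewrite /continuous_at.
apply: cvg_trans c1; move=> A hA.
have h2 := @continuous_clamp R t _ hA.
by apply: (@filterS _ (nbhs t) _ _ _ _ h2) => q; apply; rewrite /= in_itv; exact: clamp_itv.
Qed.

Lemma continuous_strain_along x : continuous (strain_along x).
Proof.
move=> t; apply: (@continuous_comp _ _ _ (fun t => (t, Phi (clamp t) x))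
  (fun p : R * (R * R) => strain (clamp p.1) p.2)); last exact: continuous_strain.
exact: (cvg_pair (@cvg_id _ _) (@continuous_flow_time x t)).
Qed.

Lemma integrable_cont01 (f : R -> R) (a b : R) : continuous f ->
  lebesgue_measure.-integrable `[a, b] (EFin \o f).
Proof.
move=> cf; apply: continuous_compact_integrable; first exact: segment_compact.
exact: continuous_subspaceT.
Qed.

(** The graph of the exponential lies above its tangent at the mean value. *)
Lemma jensen_expR (f : R -> R) : continuous f ->
  expR (\int[lebesgue_measure]_(t in `[0, 1]) f t)%R <=
  (\int[lebesgue_measure]_(t in `[0, 1]) expR (f t))%R.
Proof.
move=> cf; pose m := (\int[lebesgue_measure]_(t in `[0, 1]) f t)%R; rewrite -/m.
have ce : continuous (fun t => expR (f t)).
  by move=> t; apply: continuous_comp; [exact: cf|exact: continuous_expR].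
have cg : continuous (fun t => expR m * (1 - m) + expR m * f t).
  by move=> t; apply: cvgD; [exact: cvg_cst|apply: cvgMr; exact: cf].
have -> : expR m = (\int[lebesgue_measure]_(t in `[0, 1]) (expR m * (1 - m) + expR m * f t))%R.
  rewrite RintegralD//=; last 2 first.
  - by apply: (@integrable_cont01 (fun=> _)) => t; exact: cvg_cst.
  - by apply: (@integrable_cont01 (fun t => expR m * f t)) => t; apply: cvgMr; exact: cf.
  rewrite Rintegral_cst//= lebesgue_measure_itv/= lte_fin ltr01 /= oppr0.
  rewrite RintegralZl//=; last exact: integrable_cont01.
  by rewrite -/m; ring.
apply: le_Rintegral => //; [exact: integrable_cont01|exact: integrable_cont01|].
move=> t _; have := expR_ge1Dx (f t - m); rewrite expRD expRN => h.
have := ler_wpM2l (expR_ge0 m) h.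
by rewrite mulrCA divff ?gt_eqF ?expR_gt0//; lra.
Qed.

Lemma is_derive_int (f : R -> R) (t : R) : continuous f -> 0 < t < 1 ->
  is_derive t 1 (fun s => \int[lebesgue_measure]_(u in `[0, s]) f u)%R (f t).
Proof.
move=> cf /andP[t0 t1].
have [d e] := @continuous_FTC1_closed R f 0 t 1 t1 (integrable_cont01 0 1 cf) t0 (cf t).
by apply: DeriveDef; [exact: d|rewrite -derive1E; exact: e].
Qed.

(** By [flow_stretch] with [y] close to [x], this bounds the squared operator
    norm of the derivative of [Phi 1] at [x]. *)
Definition stretch (x : R * R) : R :=
  (\int[lebesgue_measure]_(t in `[0, 1]) expR (2 * strain_along x t))%R.

(** Gronwall's inequality with the rate of [stretch_rate], then Jensen's
    inequality. The first factor tends to [1] as [y] tends to [x]. *)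
Lemma flow_stretch x y :
  sqn (Phi 1 y - Phi 1 x) <=
  expR (8 * M * K * l1norm (y - x)) * stretch x * sqn (y - x).
Proof.
pose a := strain_along x; have ca : continuous a by exact: continuous_strain_along.
have c2a : continuous (fun t => 2 * a t) by move=> t; apply: cvgMr; exact: ca.
pose P t := (\int[lebesgue_measure]_(u in `[0, t]) (2 * a u))%R + 8 * M * K * l1norm (y - x) * t.
have cP : {within `[0, 1], continuous P}.
  move=> t; apply: cvgD; last exact: within_linear.
  by apply: parameterized_integral_continuous => //; exact: integrable_cont01.
have dP (t : R) : 0 < t < 1 -> is_derive t 1 P (2 * a t + 8 * M * K * l1norm (y - x)).
  by move=> t01; exact: (is_deriveD (is_derive_int c2a t01) (is_derive_linear _ _)).
have := energy_upper (path_derivB (flow_solution flow y) (flow_solution flow x)) cP dP (b := 0).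
move=> h; have {h} := h _ 1.
rewrite !addr0 !(flow0 flow) => h; apply: le_trans (h _ _) _.
- move=> t t01; rewrite addr0 /a /strain_along clamp_id ?itvoo_cc//.
  exact: stretch_rate.
- by rewrite ler01 lexx.
rewrite mulrC ler_wpM2r ?sqn_ge0// /P set_itv1 Rintegral_set1 mulr0 mulr1 !addr0 subr0.
by rewrite addrC expRD ler_wpM2l ?expR_ge0// jensen_expR.
Qed.

End strain.

(** * Differentiability of the flow in the initial point *)

Section flow_derivative.
Context {R : realType}.

(** To be applied to difference quotients: Cauchy at the origin with a linear
    rate. *)
Lemma cvg_of_lipschitz0 (g : R -> R) C : 0 <= C ->
  (forall h k, h != 0 -> k != 0 -> `|g k - g h| <= C * (`|k| + `|h|)) ->
  exists2 l, g @ 0^' --> l & forall h, h != 0 -> `|l - g h| <= C * `|h|.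
Proof.
move=> C0 gC.
have C1 : 0 < C + 1 by rewrite ltr_wpDl.
have cg : cvg (g @ 0^').
  apply/cauchy_cvgP/cauchy_ballP => e e0.
  have d0 : 0 < e / (2 * (C + 1)) by rewrite divr_gt0 ?mulr_gt0.
  exists ([set g k | k in [set k | k != 0 /\ `|k| < e / (2 * (C + 1))]],
          [set g k | k in [set k | k != 0 /\ `|k| < e / (2 * (C + 1))]]).
    have nb : \forall k \near (0 : R)^', k != 0 /\ `|k| < e / (2 * (C + 1)).
      near=> k; split; first by near: k; exact: nbhs_dnbhs_neq.
      by near: k; apply: dnbhs0_lt.
    by split=> /=; apply: filterS nb => k hk; exists k.
  move=> [_ _] [/= [h [h0 he] <-] [k [k0 ke] <-]].
  rewrite /ball/= /ball_ (le_lt_trans (gC _ _ k0 h0))//.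
  apply: (@le_lt_trans _ _ ((C + 1) * (`|h| + `|k|))).
    by apply: ler_wpM2r; rewrite ?addr_ge0// lerDl.
  rewrite -ltr_pdivlMl//.
  have -> : (C + 1)^-1 * e = e / (2 * (C + 1)) + e / (2 * (C + 1)).
    by field; rewrite gt_eqF.
  by rewrite ltrD.
exists (lim (g @ 0^')) => // h h0.
apply/ler_addgt0Pr => e e0.
have d0 : 0 < e / (2 * (C + 1)) by rewrite divr_gt0 ?mulr_gt0.
have e2 : 0 < e / 2 by rewrite divr_gt0.
near (0 : R)^' => k.
have k0 : k != 0 by near: k; exact: nbhs_dnbhs_neq.
have k1 : `|k| < e / (2 * (C + 1)) by near: k; apply: dnbhs0_lt.
have k2 : `|lim (g @ 0^') - g k| < e / 2.
  by near: k; move/cvgrPdist_lt : cg; apply.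
rewrite (_ : _ - _ = (lim (g @ 0^') - g k) + (g k - g h)); last by ring.
rewrite (le_trans (ler_normD _ _))//.
apply: le_trans (lerD (ltW k2) (gC _ _ h0 k0)) _.
have : C * `|k| <= (C + 1) * (e / (2 * (C + 1))).
  by apply: ler_pM => //; [rewrite lerDl|exact: ltW].
have -> : (C + 1) * (e / (2 * (C + 1))) = e / 2 by field; rewrite gt_eqF.
by lra.
Unshelve. all: by end_near. Qed.

Variables (F Phi : R -> R * R -> R * R).
Variables (G : 'I_2 -> R -> R * R -> R * R) (M : R).
Hypothesis FG : field_bounds F G M.
Hypothesis flow : is_lifted_flow F Phi.

Local Notation K := (flow_lip M).

(** The quadratic remainder of [F], of size [M * (2 * K * l1norm v)^2] for an
    initial displacement [v], amplified by the linearised flow. *)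
Definition taylor_const : R := 4 * M * K ^+ 2 * expR (2 * M + 1).

Lemma taylor_const_ge0 : 0 <= taylor_const.
Proof.
have M0 := field_M_ge0 FG.
by rewrite /taylor_const mulr_ge0 ?expR_ge0// mulr_ge0 ?sqr_ge0// mulr_ge0.
Qed.

Definition incr (t : R) (x v : R * R) : R * R := Phi t (x + v) - Phi t x.

(** The error in predicting the increment of [Phi t] along [v] linearly from its
    difference quotients of step [h] along the axes. *)
Definition secant_gap (x v : R * R) (h t : R) : R * R :=
  incr t x v - (v.1 / h) *: incr t x (h, 0) - (v.2 / h) *: incr t x (0, h).

Lemma incr_path x v : path_deriv (incr ^~ x ^~ v)
  (fun t => F t (Phi t (x + v)) - F t (Phi t x)).
Proof. exact: path_derivB (flow_solution flow _) (flow_solution flow _). Qed.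

Lemma incr_l1norm t x v : 0 <= t <= 1 -> l1norm (incr t x v) <= 2 * K * l1norm v.
Proof.
move=> t01; apply: (le_trans (flow_l1norm_upper FG flow _ _ t01)).
by rewrite addrAC subrr add0r.
Qed.

Lemma incr_field_rem t x v j : 0 <= t <= 1 ->
  `|coord2 j (F t (Phi t (x + v)) - F t (Phi t x)) -
    dirderiv G t (Phi t x) (incr t x v) j| <= 4 * M * K ^+ 2 * l1norm v ^+ 2.
Proof.
move=> t01; rewrite (_ : coord2 j (_ - _) =
    coord2 j (F t (Phi t (x + v))) - coord2 j (F t (Phi t x))); last first.
  by rewrite /coord2; case: ifP.
apply: (le_trans (field_taylor FG j _ _ t01)).
have -> : 4 * M * K ^+ 2 * l1norm v ^+ 2 = M * (2 * K * l1norm v) ^+ 2 by ring.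
rewrite ler_wpM2l ?(field_M_ge0 FG)// ler_sqr ?nnegrE ?l1norm_ge0//; first exact: incr_l1norm.
by rewrite !mulr_ge0 ?l1norm_ge0 ?flow_lip_ge0.
Qed.

(** The gap vanishes at time [0] and solves the equation linearised along the
    trajectory of [x] up to quadratic terms, so Gronwall's inequality bounds it.
    For [v] on an axis this compares two difference quotients, which therefore
    converge ([flow_partial]); as [h] tends to [0] it becomes the Taylor estimate
    ([flow_taylor]). *)
Lemma secant_gap_bound x v h t j : h != 0 -> 0 <= t <= 1 ->
  `|coord2 j (secant_gap x v h t)| <= taylor_const * (l1norm v * (l1norm v + `|h|)).
Proof.
move=> h0 t01; set E := secant_gap x v h.
have M0 := field_M_ge0 FG.
pose Q : R := 4 * M * K ^+ 2.
have Q0 : 0 <= Q by rewrite /Q mulr_ge0 ?sqr_ge0// mulr_ge0.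
pose b := Q * (l1norm v * (l1norm v + `|h|)).
have b0 : 0 <= b by rewrite /b mulr_ge0// mulr_ge0 ?addr_ge0 ?l1norm_ge0.
pose dF t w := F t (Phi t (x + w)) - F t (Phi t x).
pose dE t := dF t v - (v.1 / h) *: dF t (h, 0) - (v.2 / h) *: dF t (0, h).
have EdE : path_deriv E dE.
  exact: path_derivB (path_derivB (incr_path x v) (path_derivZ _ (incr_path x _)))
    (path_derivZ _ (incr_path x _)).
have E0 : sqn (E 0) = 0.
  rewrite /E /secant_gap /incr !(flow0 flow) ![x + _]addrC !addrK /sqn /=.
  by rewrite /GRing.scale/=; field.
have l1h : l1norm (h, 0) = `|h| by rewrite /l1norm/= normr0 addr0.
have l1h' : l1norm (0, h) = `|h| by rewrite /l1norm/= normr0 add0r.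
(* The three quadratic remainders combine to [b]; the powers of [h] in the denominators cancel. *)
have rem s i : 0 <= s <= 1 ->
    `|coord2 i (dE s) - dirderiv G s (Phi s x) (E s) i| <= b.
  move=> s01; have r0 := incr_field_rem x v i s01.
  have r1 := incr_field_rem x (h, 0) i s01; have r2 := incr_field_rem x (0, h) i s01.
  rewrite l1h in r1; rewrite l1h' in r2.
  rewrite -/(dF s _) in r0 r1 r2.
  have -> : coord2 i (dE s) - dirderiv G s (Phi s x) (E s) i =
    (coord2 i (dF s v) - dirderiv G s (Phi s x) (incr s x v) i) -
    v.1 / h * (coord2 i (dF s (h, 0)) - dirderiv G s (Phi s x) (incr s x (h, 0)) i) -
    v.2 / h * (coord2 i (dF s (0, h)) - dirderiv G s (Phi s x) (incr s x (0, h)) i).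
    by rewrite /dE /E /secant_gap /dirderiv /coord2/= /GRing.scale/=; case: ifP => _; ring.
  have hh (c r : R) : `|r| <= Q * `|h| ^+ 2 -> `|c / h * r| <= Q * (`|c| * `|h|).
    move=> hr; rewrite normrM normrM normfV.
    apply: le_trans (ler_wpM2l _ hr) _; first by rewrite mulr_ge0// invr_ge0.
    by rewrite le_eqVlt; apply/orP; left; apply/eqP; field; rewrite normr_eq0.
  rewrite (le_trans (ler_normB _ _))//.
  apply: le_trans (lerD (ler_normB _ _) (hh _ _ r2)) _.
  apply: le_trans (lerD (lerD r0 (hh _ _ r1)) (lexx _)) _.
  by rewrite /b /l1norm -/Q; have := normr_ge0 h; lra.
have rate (s : R) : 0 < s < 1 ->
    2 * dot (E s) (dE s) <= (4 * M + 2) * (sqn (E s) + b ^+ 2).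
  move=> /itvoo_cc s01.
  pose D : R * R := (dirderiv G s (Phi s x) (E s) ord0, dirderiv G s (Phi s x) (E s) ord_max).
  have -> : dot (E s) (dE s) = dot (E s) D + dot (E s) (dE s - D) by rewrite /dot/=; ring.
  have h1 : `|dot (E s) D| <= 2 * M * sqn (E s).
    by apply: dot_le_field => //; exact: (dirderiv_bound FG).
  have h2 : `|dot (E s) (dE s - D)| <= b * l1norm (E s).
    by apply: dot_le_l1norm => //; [exact: (rem s ord0 s01)|exact: (rem s ord_max s01)].
  have h3 := l1norm_le_sqn (E s); have h4 := sqr_ge0 (b - l1norm (E s)).
  have h5 : 0 <= M * b ^+ 2 by rewrite mulr_ge0 ?sqr_ge0.
  have h6 := sqr_ge0 b.
  move: h1 h2; rewrite !ler_norml => /andP[_ h1] /andP[_ h2]; nra.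
have := energy_upper EdE (@within_linear R (4 * M + 2) _)
  (fun t _ => is_derive_linear _ _) rate t01.
rewrite E0 add0r mulr0 subr0 => hE.
have hE2 : sqn (E t) <= (taylor_const * (l1norm v * (l1norm v + `|h|))) ^+ 2.
  have -> : taylor_const * (l1norm v * (l1norm v + `|h|)) = b * expR (2 * M + 1).
    by rewrite /taylor_const -/Q /b; ring.
  rewrite exprMn -expRM_natl.
  have := sqr_ge0 b => b2.
  apply: le_trans (_ : sqn (E t) + b ^+ 2 <= _); first by rewrite lerDl.
  apply: (le_trans hE); rewrite ler_wpM2l// ler_expR.
  by move: t01 => /andP[_ t1]; nra.
rewrite -ler_sqr ?nnegrE//; last first.
  by rewrite mulr_ge0 ?taylor_const_ge0// mulr_ge0 ?addr_ge0 ?l1norm_ge0.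
apply: le_trans hE2; rewrite real_normK ?num_real// /sqn /coord2.
by case: ifP => _; rewrite ?lerDl ?lerDr sqr_ge0.
Qed.

Lemma scale_e1 (h : R) : h *: (1, 0) = (h, 0) :> R * R.
Proof. by congr pair; [exact: mulr1|exact: mulr0]. Qed.

Lemma scale_e2 (h : R) : h *: (0, 1) = (0, h) :> R * R.
Proof. by congr pair; [exact: mulr0|exact: mulr1]. Qed.

Lemma coord2_incr j t x v :
  coord2 j (incr t x v) = coord2 j (Phi t (x + v)) - coord2 j (Phi t x).
Proof. by rewrite /coord2; case: ifP. Qed.

Lemma coord2_secant_gap j x v h t : coord2 j (secant_gap x v h t) =
  coord2 j (incr t x v) - v.1 * (coord2 j (incr t x (h, 0)) / h) -
  v.2 * (coord2 j (incr t x (0, h)) / h).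
Proof.
by rewrite /secant_gap /coord2; case: ifP => _ /=;
  rewrite /GRing.scale/= ![_ / h * _]mulrAC -!mulrA.
Qed.

Lemma flow_partial x t i j : 0 <= t <= 1 ->
  forall h, h != 0 ->
  `|jac (Phi t) x i j - coord2 j (incr t x (h *: basis_vec i)) / h| <=
    taylor_const * `|h|.
Proof.
move=> t01; pose g h := coord2 j (incr t x (h *: basis_vec i)) / h.
have basisE h : h *: basis_vec i = if i == ord0 then (h, 0) else (0, h) :> R * R.
  by rewrite /basis_vec; case: ifP => _; rewrite ?scale_e1 ?scale_e2.
have gC h k : h != 0 -> k != 0 -> `|g k - g h| <= taylor_const * (`|k| + `|h|).
  move=> h0 k0; have k0' : 0 < `|k| by rewrite normr_gt0.
  rewrite -(ler_pM2l k0') -normrM mulrCA.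
  have := secant_gap_bound x (k *: basis_vec i) j h0 t01.
  have mulk (a b : R) : k * (a / k - b) = a - k * b.
    by rewrite mulrBr mulrCA divff// mulr1.
  rewrite coord2_secant_gap /g mulk !basisE; case: ifP => _ /=.
    by rewrite mul0r subr0 /l1norm/= normr0 addr0.
  by rewrite mul0r subr0 /l1norm/= normr0 add0r.
have [l gl hl] := cvg_of_lipschitz0 taylor_const_ge0 gC.
suff -> : jac (Phi t) x i j = l by [].
rewrite mxE; suff d : is_derive x (basis_vec i) (fun y => coord2 j (Phi t y)) l.
  by case: d.
apply/is_deriveP; apply: cvg_trans gl; apply: near_eq_cvg; near=> h.
by rewrite /g coord2_incr [_ + x]addrC /GRing.scale/= mulrC.
Unshelve. all: by end_near. Qed.

(** [secant_gap_bound] with a step [h] so small that exchanging the difference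
    quotients for the partial derivatives costs at most [e]. *)
Lemma flow_taylor t x v j : 0 <= t <= 1 ->
  `|coord2 j (Phi t (x + v)) - coord2 j (Phi t x) -
    (v.1 * jac (Phi t) x ord0 j + v.2 * jac (Phi t) x ord_max j)| <=
  taylor_const * l1norm v ^+ 2.
Proof.
move=> t01; apply/ler_addgt0Pr => e e0.
have C0 := taylor_const_ge0; have n0 := l1norm_ge0 v.
have d0 : 0 < 2 * taylor_const * l1norm v + 1.
  by have : 0 <= taylor_const * l1norm v by [apply: mulr_ge0]; lra.
pose h := e / (2 * taylor_const * l1norm v + 1).
have h0 : 0 < h by rewrite divr_gt0.
have hn0 : h != 0 by rewrite gt_eqF.
have := secant_gap_bound x v j hn0 t01.
have := flow_partial x ord0 j t01 hn0; have := flow_partial x ord_max j t01 hn0.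
rewrite coord2_secant_gap (coord2_incr _ _ _ v) /basis_vec/=.
rewrite scale_e1 scale_e2.
set a := coord2 j (incr t x (h, 0)) / h; set b := coord2 j (incr t x (0, h)) / h.
pose f := coord2 j (Phi t (x + v)) - coord2 j (Phi t x).
pose p := jac (Phi t) x ord0 j; pose q := jac (Phi t) x ord_max j.
rewrite -/f -/p -/q.
rewrite (gtr0_norm h0) => hq hp hf.
have -> : f - (v.1 * p + v.2 * q) =
  (f - v.1 * a - v.2 * b) - v.1 * (p - a) - v.2 * (q - b) by ring.
apply: le_trans (ler_normB _ _) _; apply: le_trans (lerD (ler_normB _ _) (lexx _)) _.
rewrite !normrM.
have h1 : `|v.1| * `|p - a| <= `|v.1| * (taylor_const * h) by rewrite ler_wpM2l.
have h2 : `|v.2| * `|q - b| <= `|v.2| * (taylor_const * h) by rewrite ler_wpM2l.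
have h3 : 2 * taylor_const * l1norm v * h <= e.
  rewrite /h mulrA ler_pdivrMr// mulrC ler_wpM2l ?ltW// ; lra.
rewrite /l1norm in hf h3 *; lra.
Qed.

End flow_derivative.

(** * Lebesgue measure in the plane *)

Section plane_measure.
Context {R : realType}.
Local Notation mR := (measurableTypeR R).
Local Notation mu := (@lebesgue_measure R).

(** An open set is the countable union of the boxes with rational centre and
    radius [1/n] that it contains. *)
Lemma open_plane_measurable (O : set (R * R)) : open O -> measurable (O : set (mR * mR)).
Proof.
move=> oO.
pose B (q : rat * rat * nat) : set (mR * mR) :=
  (`[ratr q.1.1 - q.2.+1%:R^-1, ratr q.1.1 + q.2.+1%:R^-1]%classic `*`
   `[ratr q.1.2 - q.2.+1%:R^-1, ratr q.1.2 + q.2.+1%:R^-1]%classic).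
have -> : O = \bigcup_q (if `[< B q `<=` O >] then B q else set0).
  apply/seteqP; split=> [x Ox|x [q _]]; last first.
    by case: asboolP => // qO; exact: qO.
  have [e e0 eO] : exists2 e : R, 0 < e & ball x e `<=` O.
    by apply/nbhs_ballP; exact: open_nbhs_nbhs.
  pose n := Num.truncn (2 / e).
  have [u uE] : exists u : R, u = n.+1%:R^-1 by exists n.+1%:R^-1.
  have n0 : 0 < u by rewrite uE invr_gt0 ltr0n.
  have ne : u < e / 2.
    rewrite uE -[ltRHS]invf_div ltf_pV2 ?posrE ?divr_gt0//; exact: truncnS_gt.
  have [q1] := @rat_in_itvoo R (x.1 - u) (x.1 + u)
    (ltac:(by rewrite ltrBlDr -addrA ltrDl addr_gt0)).
  have [q2] := @rat_in_itvoo R (x.2 - u) (x.2 + u)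
    (ltac:(by rewrite ltrBlDr -addrA ltrDl addr_gt0)).
  rewrite !in_itv/= => /andP[q2a q2b] /andP[q1a q1b].
  exists (q1, q2, n) => //; case: asboolP => [_|].
    by split; rewrite /= in_itv/= -uE; apply/andP; split; lra.
  case=> y [/=]; rewrite !in_itv/= -!uE => /andP[y1a y1b] /andP[y2a y2b].
  apply: eO; split; rewrite /ball/= /ball_/= ltr_norml; apply/andP; split; lra.
apply: countable_bigcupT_measurable => // q.
case: asboolP => _ //; apply: measurableX; exact: measurable_itv.
Qed.

Lemma continuous_plane_measurable (f : R * R -> R) :
  continuous f -> measurable_fun setT (f : mR * mR -> mR).
Proof.
move=> /continuousP cf; apply: (measurability _ (RGenOpens.measurableE R)).
move=> _ [_ [a [b ->] <-]]; rewrite setTI; apply: open_plane_measurable.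
by apply: cf; exact: interval_open.
Qed.

Lemma continuous_plane_map_measurable (f : R * R -> R * R) :
  continuous f -> measurable_fun setT (f : mR * mR -> mR * mR).
Proof.
move=> cf; apply/measurable_fun_pairP; split; apply: continuous_plane_measurable => x.
- by have /cvg_pairP[] := cf x.
- by have /cvg_pairP[] := cf x.
Qed.

Lemma preimage_plane_measurable (f : R * R -> R * R) (A : set (mR * mR)) :
  continuous f -> measurable A -> measurable (f @^-1` A : set (mR * mR)).
Proof.
move=> cf mA; rewrite -[X in measurable X]setTI.
exact: continuous_plane_map_measurable.
Qed.

Definition shiftR (a : R) : mR -> mR := fun x => x + a.

Lemma measurable_shiftR a : measurable_fun setT (shiftR a).
Proof. exact: measurable_funD. Qed.

HB.instance Definition _ a := isMeasurableFun.Build _ _ _ _ (shiftR a)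
  (measurable_shiftR a).

Lemma lebesgue_measure_shift (a : R) (A : set mR) : measurable A ->
  mu (shiftR a @^-1` A) = mu A.
Proof.
move=> mA; rewrite -[LHS]/(pushforward mu (shiftR a) A); apply/esym.
apply: lebesgue_measure_unique => //= _ [[x y]] _ <-.
rewrite /pushforward (_ : _ @^-1` _ = `]x - a, y - a]%classic); last first.
  by apply/seteqP; split=> z /=; rewrite !in_itv/= /shiftR ltrBlDr lerBrDr.
rewrite !lebesgue_measure_itv/= !lte_fin ltrD2r.
by case: ifP => // _; rewrite -!EFinB; congr EFin; ring.
Qed.

Definition shift_plane (a : R * R) : mR * mR -> mR * mR := fun x => x + a.

Lemma measurable_shift_plane a : measurable_fun setT (shift_plane a).
Proof.
apply: continuous_plane_map_measurable => x.
by apply: cvgD; [exact: cvg_id|exact: cvg_cst].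
Qed.

HB.instance Definition _ a := isMeasurableFun.Build _ _ _ _ (shift_plane a)
  (measurable_shift_plane a).

Lemma leb2X (A B : set mR) : measurable A -> measurable B ->
  leb2 (A `*` B) = (mu A * mu B)%E.
Proof. exact: product_measure1E. Qed.

Lemma leb2_shift (a : R * R) (A : set (mR * mR)) : measurable A ->
  leb2 (shift_plane a @^-1` A) = leb2 A.
Proof.
move=> mA; rewrite -[LHS]/(pushforward leb2 (shift_plane a) A); apply/esym.
apply: product_measure_unique => //= B C mB mC.
rewrite /pushforward (_ : _ @^-1` _ = (shiftR a.1 @^-1` B) `*` (shiftR a.2 @^-1` C)); last first.
  by apply/seteqP; split=> -[x y].
rewrite leb2X ?lebesgue_measure_shift//.
- by rewrite -[X in measurable X]setTI; exact: measurable_shiftR.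
- by rewrite -[X in measurable X]setTI; exact: measurable_shiftR.
Qed.

Lemma lebesgue_measure_cc (a b : R) : a <= b -> mu `[a, b]%classic = (b - a)%:E.
Proof.
by rewrite lebesgue_measure_itv/= lte_fin le_eqVlt => /predU1P[->|->//];
  rewrite ltxx subrr.
Qed.

(** A parallelogram with two vertical sides and two sides of slope [s]. *)
Definition shear_box (c : R * R) (s r1 r2 : R) : set (mR * mR) :=
  [set y | `|y.1 - c.1| <= r1 /\ `|y.2 - c.2 - s * (y.1 - c.1)| <= r2].

Lemma measurable_le_cont (f : R * R -> R) (r : R) : continuous f ->
  measurable ([set y | f y <= r] : set (mR * mR)).
Proof.
move=> cf; have := continuous_plane_measurable cf measurableT (measurable_itv `]-oo, r]).
by rewrite setTI; congr measurable.
Qed.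

Lemma measurable_shear_box c s r1 r2 : measurable (shear_box c s r1 r2).
Proof.
apply: measurableI; apply: measurable_le_cont => y.
  by apply: cvg_norm; apply: cvgB; [exact: cvg_fst|exact: cvg_cst].
apply: cvg_norm; apply: cvgB.
  by apply: cvgB; [exact: cvg_snd|exact: cvg_cst].
by apply: cvgMr; apply: cvgB; [exact: cvg_fst|exact: cvg_cst].
Qed.

(** The vertical sections are segments of length [2 * r2]. *)
Lemma leb2_shear_box c s r1 r2 : 0 <= r1 -> 0 <= r2 ->
  ((4 * r1 * r2)%:E <= leb2 (shear_box c s r1 r2))%E.
Proof.
move=> r10 r20; rewrite /leb2 /product_measure1.
pose I : set mR := `[c.1 - r1, c.1 + r1]%classic.
have mI : measurable I by exact: measurable_itv.
apply: (@le_trans _ _ (\int[mu]_(x in I) (2 * r2)%:E)%E).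
  have muI : mu I = (2 * r1)%:E by rewrite lebesgue_measure_cc; [congr EFin|]; lra.
  apply: (@le_trans _ _ ((2 * r2)%:E * mu I)%E).
    by rewrite muI -EFinM lee_fin; lra.
  by rewrite integral_cst.
apply: (@le_trans _ _ (\int[mu]_(x in I)
    (mu \o xsection (shear_box c s r1 r2)) x)%E); last first.
  apply: ge0_subset_integral => //=.
  apply: measurable_fun_xsection; exact: measurable_shear_box.
apply: ge0_le_integral => //=.
- by move=> x _; rewrite lee_fin mulr_ge0.
- apply: measurable_funTS; apply: measurable_fun_xsection; exact: measurable_shear_box.
- move=> x; rewrite /I/= in_itv/= => /andP[x1 x2].
  have -> : xsection (shear_box c s r1 r2) x =
    `[c.2 + s * (x - c.1) - r2, c.2 + s * (x - c.1) + r2]%classic.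
    apply/seteqP; split=> y; rewrite /xsection/= inE /shear_box/= in_itv/=.
      by rewrite !ler_norml => -[_ /andP[a b]]; apply/andP; split; lra.
    by move=> /andP[a b]; split; rewrite ler_norml; apply/andP; split; lra.
  by rewrite lebesgue_measure_cc ?lee_fin; lra.
Qed.

End plane_measure.

(** * Periodic sets and discs of the torus *)

Section cells.
Context {R : realType}.
Local Notation mR := (measurableTypeR R).
Implicit Types (P E : set (R * R)) (c x : R * R) (k : int * int).

(** Sets of the torus are handled through their inverse images in the plane. *)
Definition periodic P := forall k x, P (x + zvec k) <-> P x.

Definition cell c : set (mR * mR) :=
  `[c.1, c.1 + 1[%classic `*` `[c.2, c.2 + 1[%classic.

Lemma measurable_cell c : measurable (cell c).
Proof. by apply: measurableX; exact: measurable_itv. Qed.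

Lemma torus_cell : torus = cell (0, 0) :> set (R * R).
Proof. by rewrite /cell/= add0r. Qed.

Lemma measurable_torus : measurable (torus : set (mR * mR)).
Proof. by rewrite torus_cell; exact: measurable_cell. Qed.

(** Cut [[a, a + 1]] at its integer point and translate one piece. *)
Lemma unit_interval_shift (nu : R -> R -> \bar R) :
  (forall a b d, a <= b -> b <= d -> nu a d = (nu a b + nu b d)%E) ->
  (forall a b (k : int), nu (a + k%:~R) (b + k%:~R) = nu a b) ->
  forall a, nu a (a + 1) = nu 0 1.
Proof.
move=> nuD nuP a; pose n : R := (Num.floor a)%:~R.
have := floor_part_itv a; rewrite -/n => /andP[na an].
rewrite (nuD a (n + 1)); [|lra|lra].
have -> : nu (n + 1) (a + 1) = nu n a by exact: (nuP n a 1).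
rewrite addeC -nuD; [|lra|lra].
by rewrite -(nuP 0 1 (Num.floor a)) add0r addrC.
Qed.

Lemma measure_rect_add P (J : set mR) : measurable (P : set (mR * mR)) -> measurable J ->
  forall a b c : R, a <= b -> b <= c ->
  leb2 (P `&` (`[a, c[%classic `*` J)) =
  (leb2 (P `&` (`[a, b[%classic `*` J)) + leb2 (P `&` (`[b, c[%classic `*` J)))%E.
Proof.
move=> mP mJ a b c ab bc; rewrite -measureU.
- rewrite -setIUr; congr (leb2 (P `&` _)).
  apply/seteqP; split=> -[x y] /=; rewrite !in_itv/=.
    by move=> [/andP[-> ->] ?]; rewrite andbT; have [|] := ltP x b; [left|right].
  by case=> -[/andP[h1 h2] ?]; split=> //; apply/andP; split; lra.
- by apply: measurableI => //; apply: measurableX.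
- by apply: measurableI => //; apply: measurableX.
- apply/seteqP; split=> // -[x y] /= [[_ [+ _]] [_ [+ _]]].
  by rewrite !in_itv/= => /andP[_ h1] /andP[h2 _]; lra.
Qed.

Lemma measure_rect_addr P (J : set mR) : measurable (P : set (mR * mR)) -> measurable J ->
  forall a b c : R, a <= b -> b <= c ->
  leb2 (P `&` (J `*` `[a, c[%classic)) =
  (leb2 (P `&` (J `*` `[a, b[%classic)) + leb2 (P `&` (J `*` `[b, c[%classic)))%E.
Proof.
move=> mP mJ a b c ab bc; rewrite -measureU.
- rewrite -setIUr; congr (leb2 (P `&` _)).
  apply/seteqP; split=> -[x y] /=; rewrite !in_itv/=.
    by move=> [? /andP[-> ->]]; rewrite andbT; have [|] := ltP y b; [left|right].
  by case=> -[? /andP[h1 h2]]; split=> //; apply/andP; split; lra.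
- by apply: measurableI => //; apply: measurableX.
- by apply: measurableI => //; apply: measurableX.
- apply/seteqP; split=> // -[x y] /= [[_ [_ +]] [_ [_ +]]].
  by rewrite !in_itv/= => /andP[_ h1] /andP[h2 _]; lra.
Qed.

(** Every unit cell is a fundamental domain: [unit_interval_shift] is applied in
    each coordinate. *)
Lemma leb2_cell P c : measurable (P : set (mR * mR)) -> periodic P ->
  leb2 (P `&` cell c) = leb2 (P `&` torus).
Proof.
move=> mP pP; rewrite torus_cell /cell/= add0r.
pose J : set mR := `[c.2, c.2 + 1[%classic.
pose I : set mR := `[0, 1[%classic.
transitivity (leb2 (P `&` (I `*` J))).
  apply: (@unit_interval_shift (fun a b => leb2 (P `&` (`[a, b[%classic `*` J)))).
    by apply: measure_rect_add => //; exact: measurable_itv.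
  move=> a b k.
  rewrite -[RHS](_ : leb2 (shift_plane (zvec (k, 0)) @^-1`
      (P `&` (`[a + k%:~R, b + k%:~R[%classic `*` J))) = _); last first.
    congr (leb2 _); apply/seteqP; split=> -[x y] /=; rewrite /shift_plane !in_itv/=.
      by move=> [/pP p [q r]]; split=> //; split; [lra|move: r; rewrite addr0].
    by move=> [/(pP (k, 0)) p [q r]]; split=> //; split; [lra|rewrite addr0].
  rewrite leb2_shift//; apply: measurableI => //; apply: measurableX; exact: measurable_itv.
apply: (@unit_interval_shift (fun a b => leb2 (P `&` (I `*` `[a, b[%classic)))).
  by apply: measure_rect_addr => //; exact: measurable_itv.
move=> a b k.
rewrite -[RHS](_ : leb2 (shift_plane (zvec (0, k)) @^-1`
    (P `&` (I `*` `[a + k%:~R, b + k%:~R[%classic))) = _); last first.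
  congr (leb2 _); apply/seteqP; split=> -[x y] /=; rewrite /shift_plane !in_itv/=.
    by move=> [/pP p [q r]]; split=> //; split; [move: q; rewrite addr0|lra].
  by move=> [/(pP (0, k)) p [q r]]; split=> //; split; [rewrite addr0|lra].
rewrite leb2_shift//; apply: measurableI => //; apply: measurableX; exact: measurable_itv.
Qed.

Definition periodize E : set (R * R) := [set x | exists k, E (x + zvec k)].

Lemma zvecD k l : zvec (k + l) = zvec k + zvec l :> R * R.
Proof. by rewrite /zvec/= !intrD. Qed.

Lemma zvecN k : zvec (- k) = - zvec k :> R * R.
Proof. by rewrite /zvec/= !intrN. Qed.

Lemma periodic_periodize E : periodic (periodize E).
Proof.
move=> k x; split=> -[l h].
  by exists (k + l); rewrite zvecD addrA.
exists (l - k); suff -> : x + zvec k + zvec (l - k) = x + zvec l by [].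
by rewrite -addrA -zvecD [k + _]addrC subrK.
Qed.

Lemma measurable_periodize E : measurable (E : set (mR * mR)) ->
  measurable (periodize E : set (mR * mR)).
Proof.
move=> mE; rewrite (_ : periodize E = \bigcup_k (shift_plane (zvec k) @^-1` E)); last first.
  by apply/seteqP; split=> [x [k h]|x [k _ h]]; exists k.
apply: countable_bigcupT_measurable => // k.
by rewrite -[X in measurable X]setTI; exact: measurable_shift_plane.
Qed.

Lemma periodize_cell E c : E `<=` cell c -> periodize E `&` cell c = E.
Proof.
move=> Ec; apply/seteqP; split=> [x [[k Ek] cx]|x Ex]; last first.
  by split; [exists 0; rewrite (_ : zvec 0 = 0) ?addr0|exact: Ec].
suff k0 : k = 0 by move: Ek; rewrite k0 (_ : zvec 0 = 0)// addr0.
have := Ec _ Ek; move: cx; rewrite /cell/= !in_itv/=.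
move=> [/andP[a1 a2] /andP[b1 b2]] [/andP[a3 a4] /andP[b3 b4]].
have int0 (m : int) : -1 < (m%:~R : R) -> (m%:~R : R) < 1 -> m = 0.
  move=> h1 h2; have h3 : -1 < m by rewrite -(ltr_int R) rmorphN1.
  have h4 : m < 1 by rewrite -(ltr_int R).
  lia.
by case: k {Ek} a3 a4 b3 b4 => k1 k2 /= *; congr pair; apply: int0; lra.
Qed.

(** A subset of a unit cell is mapped injectively to the torus. *)
Lemma leb2_periodize E c : measurable (E : set (mR * mR)) -> E `<=` cell c ->
  leb2 (periodize E `&` torus) = leb2 E.
Proof.
move=> mE Ec; rewrite -(leb2_cell c) ?periodize_cell//.
- exact: measurable_periodize.
- exact: periodic_periodize.
Qed.

Definition disc (eps : R) : set (mR * mR) := [set h | sqn h < eps ^+ 2].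

Lemma measurable_disc eps : measurable (disc eps).
Proof.
apply: open_plane_measurable; have /continuousP c := @continuous_sqn R.
have := c _ (@open_lt R (eps ^+ 2)); exact.
Qed.

Lemma ltr_sqr_norm (a e : R) : 0 < e -> (a ^+ 2 < e ^+ 2) = (`|a| < e).
Proof.
by move=> e0; rewrite -(real_normK (num_real a)) ltr_sqr// nnegrE ltW.
Qed.

Lemma disc_bound eps h : 0 < eps -> disc eps h -> `|h.1| < eps /\ `|h.2| < eps.
Proof.
move=> e0; rewrite /disc/= /sqn => h1.
by split; rewrite -ltr_sqr_norm//; have := sqr_ge0 h.1; have := sqr_ge0 h.2; lra.
Qed.

Lemma euclid_dist_disc x y eps : 0 < eps ->
  (euclid_dist x y < eps) = (sqn (y - x) < eps ^+ 2).
Proof.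
move=> e0; rewrite -(ger0_norm (sqrtr_ge0 _ : 0 <= euclid_dist x y)).
rewrite -ltr_sqr_norm// sqr_sqrtr ?addr_ge0 ?sqr_ge0//.
by rewrite -(sqrrN (x.1 - _)) -(sqrrN (x.2 - _)) !opprB.
Qed.

Lemma torus_ballE x eps : 0 < eps ->
  torus_ball x eps = torus `&` periodize [set y | disc eps (y - x)].
Proof.
move=> e0; apply/seteqP; split=> y [Ty h]; split=> //.
  have [|_ [k _ <-] hk] := inf_lt _ h.
    by exists (euclid_dist x (y + zvec 0)); exists 0.
  exists k => /=.
  by move: hk; rewrite (euclid_dist_disc _ _ e0).
case: h => k hk; rewrite /torus_dist.
apply: (@le_lt_trans _ _ (euclid_dist x (y + zvec k))).
  apply: ge_inf; last by exists k.
  by exists 0 => _ [l _ <-]; exact: sqrtr_ge0.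
by rewrite (euclid_dist_disc _ _ e0).
Qed.

(** For a radius less than [1/2], the disc is contained in a unit cell. *)
Lemma leb2_torus_ball x eps P : 0 < eps < 2^-1 ->
  measurable (P : set (mR * mR)) -> periodic P ->
  leb2 (torus_ball x eps `&` P) = leb2 (disc eps `&` [set h | P (x + h)]).
Proof.
move=> /andP[e0 e1] mP pP; pose E : set (mR * mR) := [set y | disc eps (y - x)] `&` P.
have mD : measurable ([set y | disc eps (y - x)] : set (mR * mR)).
  have := measurable_shift_plane (- x) measurableT (measurable_disc eps).
  by rewrite setTI.
have -> : torus_ball x eps `&` P = periodize E `&` torus.
  rewrite torus_ballE//; apply/seteqP; split=> y.
    by move=> [[Ty [k h]] Py]; split=> //; exists k; split=> //; exact/pP.
  by move=> [[k [h /pP Py]] Ty]; split=> //; split=> //; exists k.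
rewrite (@leb2_periodize _ (x - (2^-1, 2^-1))); last 2 first.
- exact: measurableI.
- move=> y [/(disc_bound e0) + _]; rewrite !ltr_norml/= => -[/andP[a b] /andP[c d]].
  by split; rewrite /= in_itv/=; apply/andP; split; lra.
rewrite -(leb2_shift x); last exact: measurableI.
congr (leb2 _); apply/seteqP; split=> h; rewrite /shift_plane /E/= addrK [h + x]addrC.
  by [].
by [].
Qed.

End cells.

(** * Area of the images of grid squares *)

Section parallelogram.
Context {R : realType}.

(** The sloped sides are taken parallel to [p]. Cramer's rule gives the
    coordinates [a] and [b]: the height of the box bounds [b] by [r / 2], and then
    [|q.1| <= |p.1|] bounds [a] by [r]. *)
Lemma shear_box_parallelogram_aux (p q : R * R) (r : R) : 0 <= r ->
  p.1 * q.2 - p.2 * q.1 != 0 -> `|q.1| <= `|p.1| ->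
  exists s r1 r2 : R, [/\ 0 <= r1, 0 <= r2,
    4 * r1 * r2 = r ^+ 2 * `|p.1 * q.2 - p.2 * q.1| &
    forall c y, shear_box c s r1 r2 y -> exists a b, [/\ `|a| <= r, `|b| <= r &
      y = c + (a *: p + b *: q)]].
Proof.
case: p q => p1 p2 [q1 q2] /=; set d := p1 * q2 - p2 * q1 => r0 d0 qp.
have p0 : p1 != 0.
  apply: contra_neq d0 => p0; rewrite /d p0 mul0r sub0r.
  by move: qp; rewrite p0 normr0 normr_le0 => /eqP ->; rewrite mulr0 oppr0.
have p0' : 0 < `|p1| by rewrite normr_gt0.
have d0' : 0 < `|d| by rewrite normr_gt0.
exists (p2 / p1), (`|p1| * r / 2), (`|d| * r / (2 * `|p1|)); split.
- by rewrite divr_ge0// mulr_ge0.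
- by rewrite divr_ge0 ?mulr_ge0.
- by field; rewrite gt_eqF.
move=> [c1 c2] [y1 y2]; rewrite /shear_box/=.
have [u uE] : exists u, u = y1 - c1 by exists (y1 - c1).
have [v vE] : exists v, v = y2 - c2 by exists (y2 - c2).
rewrite -uE -vE => -[hu hv].
pose b := (v - p2 / p1 * u) * (p1 / d).
have hb : `|b| <= r / 2.
  rewrite /b normrM normrM normfV.
  apply: le_trans (ler_wpM2r _ hv) _; first by rewrite mulr_ge0 ?invr_ge0.
  rewrite le_eqVlt; apply/orP; left; apply/eqP; field.
  by rewrite !gt_eqF.
have ha : `|(u - b * q1) / p1| <= r.
  rewrite normrM normfV ler_pdivrMr//.
  apply: le_trans (ler_normB _ _) _; rewrite normrM.
  have : `|b| * `|q1| <= r / 2 * `|p1| by apply: ler_pM.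
  by lra.
exists ((u - b * q1) / p1), b; split=> //; first by rewrite (le_trans hb)//; lra.
have -> : y1 = c1 + u by rewrite uE addrC subrK.
have -> : y2 = c2 + v by rewrite vE addrC subrK.
congr pair => /=; rewrite /GRing.scale/=; congr (_ + _).
  by rewrite mulfVK// subrK.
have -> : v = p2 / p1 * u + b * (d / p1).
  by rewrite /b; field; rewrite p0 d0.
by rewrite /d; field.
Qed.

(** The parallelogram of the [a *: p + b *: q] with [|a|, |b| <= r] contains a
    sheared box of a quarter of its area, measured by [leb2_shear_box]. *)
Lemma shear_box_parallelogram (p q : R * R) (r : R) : 0 <= r ->
  p.1 * q.2 - p.2 * q.1 != 0 ->
  exists s r1 r2 : R, [/\ 0 <= r1, 0 <= r2,
    4 * r1 * r2 = r ^+ 2 * `|p.1 * q.2 - p.2 * q.1| &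
    forall c y, shear_box c s r1 r2 y -> exists a b, [/\ `|a| <= r, `|b| <= r &
      y = c + (a *: p + b *: q)]].
Proof.
move=> r0 d0; have [qp|/ltW pq] := leP `|q.1| `|p.1|.
  exact: shear_box_parallelogram_aux.
have E : `|q.1 * p.2 - q.2 * p.1| = `|p.1 * q.2 - p.2 * q.1|.
  by rewrite -normrN opprB mulrC [q.1 * _]mulrC.
have d0' : q.1 * p.2 - q.2 * p.1 != 0 by rewrite -normr_eq0 E normr_eq0.
have [s [r1 [r2 [? ? h1 h2]]]] := shear_box_parallelogram_aux r0 d0' pq.
exists s, r1, r2; split=> //; first by rewrite -E.
by move=> c y /h2[a [b [ha hb ->]]]; exists b, a; split=> //; rewrite [b *: _ + _]addrC.
Qed.

End parallelogram.

Section flow_inverse.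
Context {R : realType}.
Local Notation mR := (measurableTypeR R).
Variables (F Phi : R -> R * R -> R * R).
Variables (G : 'I_2 -> R -> R * R -> R * R) (M : R).
Hypothesis FG : field_bounds F G M.
Hypothesis flow : is_lifted_flow F Phi.

Local Notation K := (flow_lip M).

Definition flow_inv (t : R) (z : R * R) : R * R := xget 0 [set x | Phi t x = z].

Lemma flow_invK t z : 0 <= t <= 1 -> Phi t (flow_inv t z) = z.
Proof.
move=> t01; have [x xz] := flow_surj FG flow z t01.
by rewrite /flow_inv; case: xgetP => [y _ //|/(_ x)].
Qed.

Lemma flowK t x : 0 <= t <= 1 -> flow_inv t (Phi t x) = x.
Proof. by move=> t01; apply: (flow_inj FG flow t01); rewrite flow_invK. Qed.

Lemma flow_inv_l1norm t z w : 0 <= t <= 1 ->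
  l1norm (flow_inv t z - flow_inv t w) <= 2 * K * l1norm (z - w).
Proof.
move=> t01; rewrite -{2}(flow_invK z t01) -{2}(flow_invK w t01).
exact: (flow_l1norm_lower FG flow).
Qed.

Lemma continuous_flow_inv t : 0 <= t <= 1 -> continuous (flow_inv t).
Proof. by move=> t01; apply: l1norm_lipschitz_continuous => z w; exact: flow_inv_l1norm. Qed.

Lemma flow_inv_period t z k : 0 <= t <= 1 ->
  flow_inv t (z + zvec k) = flow_inv t z + zvec k.
Proof.
move=> t01; apply: (flow_inj FG flow t01).
by rewrite (flow_period FG flow)// !flow_invK.
Qed.

Lemma periodic_flow_inv t P : 0 <= t <= 1 -> periodic P -> periodic (flow_inv t @^-1` P).
Proof. by move=> t01 pP k x; rewrite /= flow_inv_period. Qed.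

Definition grid_box (N i j : nat) : set (mR * mR) :=
  `[i%:R / N%:R, i.+1%:R / N%:R[%classic `*` `[j%:R / N%:R, j.+1%:R / N%:R[%classic.

Definition grid_center (N i j : nat) : R * R :=
  ((i%:R + 2^-1) / N%:R, (j%:R + 2^-1) / N%:R).

(** The image under [Phi t] of a grid square of the torus, as a periodic set. *)
Definition image_box (t : R) (N i j : nat) : set (R * R) :=
  flow_inv t @^-1` (periodize (grid_box N i j)).

Lemma measurable_image_box t N i j : 0 <= t <= 1 ->
  measurable (image_box t N i j : set (mR * mR)).
Proof.
move=> t01; apply: preimage_plane_measurable; first exact: continuous_flow_inv.
by apply: measurable_periodize; apply: measurableX; exact: measurable_itv.
Qed.

Lemma periodic_image_box t N i j : 0 <= t <= 1 -> periodic (image_box t N i j).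
Proof. by move=> t01; apply: periodic_flow_inv => //; exact: periodic_periodize. Qed.

Lemma grid_unit_itv (N i : nat) : (i < N)%N -> 0 <= ((i%:R + 2^-1) / N%:R : R) < 1.
Proof.
move=> iN; have N0 : 0 < N%:R :> R by rewrite ltr0n (leq_ltn_trans _ iN).
have : i.+1%:R <= N%:R :> R by rewrite ler_nat.
rewrite -natr1 => h; have i0 : 0 <= i%:R :> R by rewrite ler0n.
by rewrite divr_ge0 ?(ltW N0)//= ?ltr_pdivrMr//; lra.
Qed.

Lemma grid_center_torus N i j : (i < N)%N -> (j < N)%N -> torus (grid_center N i j).
Proof. by move=> iN jN; split; rewrite /= in_itv/= grid_unit_itv. Qed.

Lemma grid_boxP N i j (x : R * R) : (0 < N)%N ->
  `|x.1 - (grid_center N i j).1| < 2^-1 / N%:R ->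
  `|x.2 - (grid_center N i j).2| < 2^-1 / N%:R -> grid_box N i j x.
Proof.
move=> N0; rewrite /grid_box /grid_center/= !in_itv/= -(natr1 i) -(natr1 j) !mulrDl !ltr_norml.
have -> : 1 / N%:R = 2^-1 / N%:R + 2^-1 / N%:R :> R by rewrite -mulrDl; congr (_ / _); lra.
have [a <-] : exists a, a = i%:R / N%:R :> R by eexists.
have [b <-] : exists b, b = j%:R / N%:R :> R by eexists.
have [e <-] : exists e, e = 2^-1 / N%:R :> R by eexists.
by move=> /andP[h1 h2] /andP[h3 h4]; split; apply/andP; split; lra.
Qed.

Variable kappa' : R.
Hypothesis kappa'0 : 0 < kappa'.
Hypothesis hdet : forall t x, 0 <= t <= 1 -> torus x -> kappa' <= `| \det (jac (Phi t) x) |.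

(** On a square of mesh [1/N] the Taylor remainder of the flow, transported back
    by the inverse of the flow, is then less than a quarter of the mesh. *)
Definition grid_fine (N : nat) : Prop := 4 * K * (taylor_const M + 1) < N%:R.

Lemma det_mx2 (A : 'M[R]_2) :
  \det A = A ord0 ord0 * A ord_max ord_max - A ord0 ord_max * A ord_max ord0.
Proof.
rewrite (expand_det_row _ ord0) big_ord_recl big_ord1 /cofactor !det_mx11 !mxE.
rewrite (_ : lift ord0 ord0 = ord_max); last exact/val_inj.
rewrite (_ : lift ord_max ord0 = ord0); last exact/val_inj.
by rewrite expr0 expr1 mul1r mulN1r mulrN.
Qed.

(** The image contains every point [y = Phi t c + D (a, b)], with [D] the
    derivative at the centre [c] and [|a|, |b| <= r = 1/(4N)]: by [flow_taylor] and
    the Lipschitz bound of the inverse, the preimage of [y] is closer than [r] to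
    [c + (a, b)], hence in the grid square. These points fill a parallelogram of
    area [4 * r^2 * |det D|]. *)
Lemma image_box_area t N i j : 0 <= t <= 1 -> grid_fine N ->
  (i < N)%N -> (j < N)%N ->
  ((kappa' / 16 / N%:R ^+ 2)%:E <= leb2 (image_box t N i j `&` torus))%E.
Proof.
move=> t01 fineN iN jN; set c := grid_center N i j.
have N0 : 0 < N%:R :> R by rewrite ltr0n (leq_ltn_trans _ iN).
have C0 := taylor_const_ge0 FG; have K1 := flow_lip_ge1 FG.
pose r : R := 4^-1 / N%:R; have r0 : 0 < r by rewrite divr_gt0.
have rN : 2^-1 / N%:R = 2 * r by rewrite /r; field; rewrite gt_eqF.
have fine1 : 16 * K * taylor_const M * r < 1.
  rewrite /r mulrA ltr_pdivrMr// mul1r; apply: le_lt_trans fineN.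
  by have : 0 <= K * taylor_const M by [apply: mulr_ge0; lra]; lra.
have fine2 : 16 * K * r < 1.
  rewrite /r mulrA ltr_pdivrMr// mul1r; apply: le_lt_trans fineN.
  by have : 0 <= K * taylor_const M by [apply: mulr_ge0; lra]; lra.
pose J := jac (Phi t) c.
pose p : R * R := (J ord0 ord0, J ord0 ord_max).
pose q : R * R := (J ord_max ord0, J ord_max ord_max).
have dJ : kappa' <= `|p.1 * q.2 - p.2 * q.1|.
  by rewrite -det_mx2; apply: hdet => //; exact: grid_center_torus.
have d0 : p.1 * q.2 - p.2 * q.1 != 0 by rewrite -normr_gt0 (lt_le_trans kappa'0).
have [s [r1 [r2 [r10 r20 r12 sub]]]] := shear_box_parallelogram (ltW r0) d0.
pose B := shear_box (Phi t c) s r1 r2.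
have key y : B y -> grid_box N i j (flow_inv t y) /\ l1norm (y - Phi t c) < 2^-1.
  move=> /sub[a [b [ha hb yE]]].
  pose w := c + (a, b); set z := flow_inv t y.
  have nab : l1norm (a, b) <= 2 * r by rewrite /l1norm/=; lra.
  have yw : l1norm (Phi t w - y) <= 8 * taylor_const M * r ^+ 2.
    have T k := flow_taylor FG flow c (a, b) k t01.
    have T0 := T ord0; have T1 := T ord_max.
    have : taylor_const M * l1norm (a, b) ^+ 2 <= taylor_const M * (2 * r) ^+ 2.
      by rewrite ler_wpM2l// ler_sqr ?nnegrE ?l1norm_ge0//; lra.
    have E0 : (Phi t w - y).1 = coord2 ord0 (Phi t w) - coord2 ord0 (Phi t c) -
        (a * J ord0 ord0 + b * J ord_max ord0).
      by rewrite yE /coord2/= /GRing.scale/=; ring.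
    have E1 : (Phi t w - y).2 = coord2 ord_max (Phi t w) - coord2 ord_max (Phi t c) -
        (a * J ord0 ord_max + b * J ord_max ord_max).
      by rewrite yE /coord2/= /GRing.scale/=; ring.
    move: T0 T1 => /= T0 T1 h; rewrite [leLHS]/l1norm E0 E1; lra.
  have wz : l1norm (w - z) <= r * (16 * K * taylor_const M * r).
    rewrite -(flowK w t01); apply: (le_trans (flow_inv_l1norm _ _ t01)).
    by have := ler_wpM2l (_ : 0 <= 2 * K) yw; rewrite mulr_ge0// => [/(_ isT)|]; lra.
  have wz' : l1norm (w - z) < r by apply: (le_lt_trans wz); rewrite gtr_pMr.
  have zc1 : `|z.1 - c.1| < 2^-1 / N%:R.
    rewrite rN (_ : z.1 - c.1 = a - (w - z).1); last by rewrite /w/=; ring.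
    by have := coord1_l1norm (w - z); have := ler_normB a (w - z).1; lra.
  have zc2 : `|z.2 - c.2| < 2^-1 / N%:R.
    rewrite rN (_ : z.2 - c.2 = b - (w - z).2); last by rewrite /w/=; ring.
    by have := coord2_l1norm (w - z); have := ler_normB b (w - z).2; lra.
  split; first by apply: grid_boxP => //; rewrite -(ltr0n R).
  rewrite -(flow_invK y t01) -/z; apply: (le_lt_trans (flow_l1norm_upper FG flow _ _ t01)).
  have h4 : l1norm (z - c) <= 4 * r by rewrite /l1norm/=; rewrite rN in zc1 zc2; lra.
  have K0 : 0 <= 2 * K by lra.
  by have := ler_wpM2l K0 h4; lra.
rewrite -(leb2_cell (Phi t c - (2^-1, 2^-1))); last 2 first.
- exact: measurable_image_box.
- exact: periodic_image_box.
apply: (@le_trans _ _ (leb2 B)).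
  apply: le_trans (leb2_shear_box _ _ r10 r20).
  rewrite r12 lee_fin; apply: (@le_trans _ _ (r ^+ 2 * kappa')).
    by rewrite /r le_eqVlt; apply/orP; left; apply/eqP; field; rewrite gt_eqF.
  by rewrite ler_wpM2l ?sqr_ge0.
apply: le_measure; rewrite ?inE.
- exact: measurable_shear_box.
- by apply: measurableI; [exact: measurable_image_box|exact: measurable_cell].
move=> y /key[gy]; have := coord1_l1norm (y - Phi t c); have := coord2_l1norm (y - Phi t c).
move=> h1 h2 h3; split.
  by exists 0; rewrite (_ : zvec 0 = 0)// addr0.
have := le_lt_trans h1 h3; have := le_lt_trans h2 h3.
rewrite !ltr_norml/= => /andP[? ?] /andP[? ?].
by split; rewrite /= in_itv/=; apply/andP; split; lra.
Qed.

End flow_inverse.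

(** * Transport of sums over the grid *)

Section nonneg_integral.
Local Open Scope ereal_scope.
Context d (T : measurableType d) (R : realType) (mu : {measure set T -> \bar R}).

Import HBNNSimple.

(** The integral of a nonnegative function is the supremum of the integrals of
    the simple functions below it. *)
Lemma ge0_integral_mono (D : set T) (f1 f2 : T -> \bar R) :
  (forall x, D x -> 0 <= f1 x) -> (forall x, D x -> f1 x <= f2 x) ->
  \int[mu]_(x in D) f1 x <= \int[mu]_(x in D) f2 x.
Proof.
move=> f10 f12; rewrite (integral_mkcond D f1) (integral_mkcond D f2).
have h1 x : 0 <= (f1 \_ D) x by rewrite patchE; case: ifPn => // /set_mem; exact: f10.
have h12 x : (f1 \_ D) x <= (f2 \_ D) x.
  by rewrite !patchE; case: ifPn => // /set_mem; exact: f12.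
have h2 x : 0 <= (f2 \_ D) x by exact: le_trans (h12 x).
rewrite !ge0_integralTE//; apply: ereal_sup_le => _ [h hf <-].
by exists h => // x; exact: le_trans (hf x) (h12 x).
Qed.

End nonneg_integral.

Section strain_lipschitz.
Context {R : realType}.
Variables (F : R -> R * R -> R * R) (G : 'I_2 -> R -> R * R -> R * R) (M : R).
Hypothesis FG : field_bounds F G M.

Lemma strain_lip t x y : 0 <= t <= 1 ->
  strain F t x <= strain F t y + 4 * M * l1norm (x - y).
Proof.
move=> t01; have M0 := field_M_ge0 FG.
have n0 := l1norm_ge0 (x - y).
pose e := M * l1norm (x - y); have e0 : 0 <= e by rewrite mulr_ge0.
have lip i j : `|coord2 j (G i t x) - coord2 j (G i t y)| <= e by exact: (fb_lip FG).
have s0 := strain_ge0 F t y.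
rewrite -mulrA -/e -ler_sqr ?nnegrE ?strain_ge0//; last lra.
have sq z : strain F t z ^+ 2 = (G ord0 t z).1 ^+ 2 + (G ord0 t z).2 ^+ 2 +
    ((G ord_max t z).1 ^+ 2 + (G ord_max t z).2 ^+ 2).
  by rewrite (strainE FG)// sqr_sqrtr ?addr_ge0 ?sqr_ge0.
have sqy := sq y; rewrite sq.
have := lip ord0 ord0; have := lip ord0 ord_max.
have := lip ord_max ord0; have := lip ord_max ord_max.
rewrite /coord2/=.
move: (G ord0 t x).1 (G ord0 t x).2 (G ord_max t x).1 (G ord_max t x).2.
move: (G ord0 t y).1 (G ord0 t y).2 (G ord_max t y).1 (G ord_max t y).2 sqy.
move: (strain F t y) s0 => s s0 a b c d sE a' b' c' d' hd hc hb ha.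
have entry (u u' : R) : u ^+ 2 <= s ^+ 2 -> `|u' - u| <= e ->
    u' ^+ 2 <= u ^+ 2 + 2 * s * e + e ^+ 2.
  move=> us; have us' : `|u| <= s.
    by rewrite -ler_sqr ?nnegrE// real_normK ?num_real.
  move=> ue; have h1 : (u' - u) ^+ 2 <= e ^+ 2.
    by rewrite -(real_normK (num_real (u' - u))) ler_sqr ?nnegrE.
  have h2 : u * (u' - u) <= s * e.
    by rewrite (le_trans (ler_norm _))// normrM ler_pM.
  by have -> : u' = u + (u' - u) by [ring]; lra.
have sa := sqr_ge0 a; have sb := sqr_ge0 b; have sc := sqr_ge0 c; have sd := sqr_ge0 d.
have := entry a a' (ltac:(lra)) ha; have := entry b b' (ltac:(lra)) hb.
have := entry c c' (ltac:(lra)) hc; have := entry d d' (ltac:(lra)) hd.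
have := sqr_ge0 e; lra.
Qed.

Lemma expR_half_le2 (x : R) : x <= 2^-1 -> expR x <= 2.
Proof.
move=> x2; have := expR_ge1Dx (- x); rewrite expRN => h.
by rewrite -[leRHS]invrK -[leLHS]invrK lef_pV2 ?posrE ?invr_gt0 ?expR_gt0//; lra.
Qed.

End strain_lipschitz.

Section transport.
Context {R : realType}.
Local Notation mR := (measurableTypeR R).
Variables (F Phi : R -> R * R -> R * R).
Variables (G : 'I_2 -> R -> R * R -> R * R) (M : R).
Hypothesis FG : field_bounds F G M.
Hypothesis flow : is_lifted_flow F Phi.

Variable kappa' : R.
Hypothesis kappa'0 : 0 < kappa'.
Hypothesis hdet : forall t x, 0 <= t <= 1 -> torus x -> kappa' <= `| \det (jac (Phi t) x) |.

Lemma grid_index_inj (N i i' : nat) (x : R) : (0 < N)%N ->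
  i%:R / N%:R <= x < i.+1%:R / N%:R -> i'%:R / N%:R <= x < i'.+1%:R / N%:R -> i = i'.
Proof.
move=> N0 /andP[h1 h2] /andP[h3 h4].
have N0' : 0 < N%:R^-1 :> R by rewrite invr_gt0 ltr0n.
have := le_lt_trans h1 h4; have := le_lt_trans h3 h2.
by rewrite !(ltr_pM2r N0') !ltr_nat; lia.
Qed.

Lemma grid_box_torus N i j : (i < N)%N -> (j < N)%N ->
  @grid_box R N i j `<=` cell (0, 0).
Proof.
move=> iN jN [x y]; rewrite /grid_box/cell/= !in_itv/= !add0r.
have N0 : 0 < N%:R :> R by rewrite ltr0n (leq_ltn_trans _ iN).
have aux k z : (k < N)%N -> k%:R / N%:R <= z < k.+1%:R / N%:R -> 0 <= (z : R) < 1.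
  move=> kN /andP[h1 h2]; apply/andP; split.
    by apply: le_trans h1; rewrite divr_ge0 ?ler0n.
  by apply: (lt_le_trans h2); rewrite ler_pdivrMr// mul1r ler_nat.
by move=> [h1 h2]; split; [exact: (aux i x iN h1)|exact: (aux j y jN h2)].
Qed.

Lemma image_box_disj t N i j i' j' y :
  (i < N)%N -> (j < N)%N -> (i' < N)%N -> (j' < N)%N ->
  image_box Phi t N i j y -> image_box Phi t N i' j' y -> i = i' /\ j = j'.
Proof.
move=> iN jN i'N j'N; have N0 : (0 < N)%N by exact: leq_ltn_trans iN.
rewrite /image_box/=; set z := flow_inv Phi t y => -[k hk] [k' hk'].
have E : z + zvec k = z + zvec k'.
  pose S : set (R * R) := [set z + zvec k'].
  have S1 : S `<=` cell (0, 0) by move=> _ ->; exact: (grid_box_torus i'N j'N).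
  have : (periodize S `&` cell (0, 0)) (z + zvec k).
    split; last exact: (grid_box_torus iN jN).
    by exists (k' - k); rewrite -addrA -zvecD addrC [k + _]addrC subrK addrC.
  by rewrite (periodize_cell S1).
move: hk hk'; rewrite E /grid_box/= !in_itv/= => -[a b] [c d].
by split; [exact: grid_index_inj a c|exact: grid_index_inj b d].
Qed.

(** A discrete change of variables: the images of the grid squares are disjoint,
    and each of them has area at least [kappa' / 16 / N^2]. *)
Lemma transport t N (I : finType) (a b : I -> nat) (g : I -> R) (f : R * R -> R) :
  0 <= t <= 1 -> grid_fine M N ->
  (forall p, (a p < N)%N) -> (forall p, (b p < N)%N) ->
  (forall p q, a p = a q -> b p = b q -> p = q) ->
  (forall p, 0 <= g p) -> measurable_fun setT (f : mR * mR -> mR) ->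
  (forall y, 0 <= f y) ->
  (forall p y, image_box Phi t N (a p) (b p) y -> g p <= f y) ->
  ((kappa' / 16 / N%:R ^+ 2 * \sum_p g p)%:E <= \int[leb2]_(y in torus) (f y)%:E)%E.
Proof.
move=> t01 fineN aN bN inj g0 mf f0 gf.
pose A p : set (mR * mR) := image_box Phi t N (a p) (b p).
have mA p : measurable (A p) by exact: (measurable_image_box FG flow).
apply: (@le_trans _ _ (\int[leb2]_(y in torus) (\sum_p (g p * \1_(A p) y)%:E))%E).
  rewrite ge0_integral_sum//; last 3 first.
  - exact: measurable_torus.
  - move=> p; apply/measurable_EFinP; exact: measurable_funM.
  - by move=> p y _; rewrite lee_fin mulr_ge0.
  rewrite mulr_sumr -sumEFin; apply: lee_sum => p _.
  under eq_integral do rewrite EFinM.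
  rewrite ge0_integralZl//; last 3 first.
  - exact: measurable_torus.
  - by apply/measurable_EFinP.
  - by rewrite lee_fin.
  rewrite integral_indic//; last exact: measurable_torus.
  rewrite mulrC EFinM; apply: lee_wpmul2l; first by rewrite lee_fin.
  exact: (image_box_area FG flow kappa'0 hdet).
apply: ge0_integral_mono => y _.
  by apply: sume_ge0 => p _; rewrite lee_fin mulr_ge0.
rewrite sumEFin lee_fin.
have [[p Ap]|nA] := pselect (exists p, A p y); last first.
  rewrite big1// => p _; rewrite indicE memNset ?mulr0// => Ap.
  by apply: nA; exists p.
rewrite (bigD1 p)//= big1 ?addr0; last first.
  move=> q qp; rewrite indicE memNset ?mulr0// => Aq; move/eqP: qp; apply.
  by have [] := image_box_disj (aN q) (bN q) (aN p) (bN p) Aq Ap; exact: inj.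
by rewrite indicE mem_set// mulr1; exact: gf Ap.
Qed.

End transport.

(** * Energy of the grid and area of the inner strip *)

Section strips.
Context {R : realType}.
Local Notation mR := (measurableTypeR R).

(** The inverse image in the plane of a horizontal strip of the torus. *)
Definition strip (a b : R) : set (R * R) :=
  [set x | exists k : int, a <= x.2 + k%:~R < b].

Lemma periodic_strip a b : periodic (strip a b).
Proof.
move=> [k1 k2] x; split=> -[k h].
  by exists (k2 + k); rewrite intrD addrA.
by exists (k - k2); rewrite /= -addrA -intrD [k2 + _]addrC subrK.
Qed.

Lemma measurable_strip a b : measurable (strip a b : set (mR * mR)).
Proof.
rewrite (_ : strip a b = \bigcup_(k : int) (setT `*` `[a - k%:~R, b - k%:~R[%classic)); last first.
  apply/seteqP; split=> x.
    by move=> [k h]; exists k => //; split=> //=; rewrite in_itv/= lerBlDr ltrBrDr.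
  by move=> [k _ [_]]; rewrite /= in_itv/= lerBlDr ltrBrDr => h; exists k.
apply: countable_bigcupT_measurable => // k.
by apply: measurableX => //; exact: measurable_itv.
Qed.

End strips.

Section energy.
Context {R : realType}.
Local Notation mR := (measurableTypeR R).
Local Notation mu := (@lebesgue_measure R).
Variables (F Phi : R -> R * R -> R * R).
Variables (G : 'I_2 -> R -> R * R -> R * R) (M : R).
Hypothesis FG : field_bounds F G M.
Hypothesis flow : is_lifted_flow F Phi.

Local Notation K := (flow_lip M).

Variable kappa' : R.
Hypothesis kappa'0 : 0 < kappa'.
Hypothesis hdet : forall t x, 0 <= t <= 1 -> torus x -> kappa' <= `| \det (jac (Phi t) x) |.

Lemma grid_box_center N i j (x : R * R) : (0 < N)%N -> grid_box N i j x ->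
  `|x.1 - (grid_center N i j).1| <= 2^-1 / N%:R /\
  `|x.2 - (grid_center N i j).2| <= 2^-1 / N%:R.
Proof.
move=> N0; rewrite /grid_box /grid_center/= !in_itv/= -(natr1 i) -(natr1 j) !mulrDl !ler_norml.
have -> : 1 / N%:R = 2^-1 / N%:R + 2^-1 / N%:R :> R by rewrite -mulrDl; congr (_ / _); lra.
have [a <-] : exists a, a = i%:R / N%:R :> R by eexists.
have [b <-] : exists b, b = j%:R / N%:R :> R by eexists.
have [e <-] : exists e, e = 2^-1 / N%:R :> R by eexists.
by move=> [/andP[h1 h2] /andP[h3 h4]]; split; apply/andP; split; lra.
Qed.

Lemma continuous_strain_space t : 0 <= t <= 1 -> continuous (strain F t).
Proof.
move=> t01; have -> : strain F t = (fun p : R * (R * R) => strain F (clamp p.1) p.2) \o pair t.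
  by apply/funext => y; rewrite /= clamp_id.
move=> x; apply: continuous_comp; last exact: (continuous_strain FG).
exact: (cvg_pair (@cvg_cst _ _ _ _ _) (@cvg_id _ _)).
Qed.

(** [transport] at time [t]. On the image of a grid square the strain varies by
    at most [1/4], so [exp (2 * strain)] varies by at most a factor [2]. *)
Lemma strain_sum t N : 0 <= t <= 1 -> grid_fine M N -> 32 * M * K <= N%:R ->
  ((kappa' / 32 / N%:R ^+ 2 * \sum_(p : 'I_N * 'I_N)
      expR (2 * strain F t (Phi t (grid_center N p.1 p.2))))%:E <=
   \int[leb2]_(y in torus) (expR (2 * strain F t y))%:E)%E.
Proof.
move=> t01 fineN Nbig.
pose g (p : 'I_N * 'I_N) := expR (2 * strain F t (Phi t (grid_center N p.1 p.2))) / 2.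
have -> : kappa' / 32 / N%:R ^+ 2 * \sum_(p : 'I_N * 'I_N)
      expR (2 * strain F t (Phi t (grid_center N p.1 p.2))) =
      kappa' / 16 / N%:R ^+ 2 * \sum_p g p.
  by rewrite -mulr_suml; move: (\sum_p _) ((N%:R ^+ 2)^-1) => x y; lra.
apply: (@transport R F Phi G M FG flow kappa' kappa'0 hdet t N _
  (fun p : 'I_N * 'I_N => p.1 : nat) (fun p => p.2 : nat) g
  (fun y => expR (2 * strain F t y)) t01 fineN) => //.
- by move=> [i j] [i' j'] /= /val_inj -> /val_inj ->.
- by move=> p; rewrite divr_ge0 ?expR_ge0.
- apply: continuous_plane_measurable => y.
  apply: continuous_comp; last exact: continuous_expR.
  by apply: cvgMr; exact: continuous_strain_space.
move=> [i j] y /= [k hk]; rewrite /g/=; set c := grid_center N i j.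
have N0 : (0 < N)%N by exact: leq_ltn_trans (ltn_ord i).
have N0' : 0 < N%:R :> R by rewrite ltr0n.
have [h1 h2] := grid_box_center N0 hk.
set w := flow_inv Phi t y + zvec k in hk h1 h2.
have yE : strain F t y = strain F t (Phi t w).
  by rewrite /w (flow_period FG flow _ _ t01) (flow_invK FG flow y t01) (strain_period FG y k t01).
have M0 := field_M_ge0 FG; have K0 := flow_lip_ge1 FG.
have cw : l1norm (c - w) <= N%:R^-1.
  rewrite l1normB (_ : l1norm (w - c) = `|w.1 - c.1| + `|w.2 - c.2|)//.
  apply: le_trans (lerD h1 h2) _.
  by rewrite -mulrDl (_ : 2^-1 + 2^-1 = 1) ?mul1r//; lra.
have h3 : l1norm (Phi t c - Phi t w) <= 2 * K * N%:R^-1.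
  by apply: (le_trans (flow_l1norm_upper FG flow _ _ t01)); rewrite ler_wpM2l//; lra.
have h4 := strain_lip FG (Phi t c) (Phi t w) t01.
have h5 : M * l1norm (Phi t c - Phi t w) <= M * (2 * K * N%:R^-1) by rewrite ler_wpM2l.
have h6 : 32 * M * K * N%:R^-1 <= 1 by rewrite ler_pdivrMr// mul1r.
rewrite ler_pdivrMr// yE.
apply: (@le_trans _ _ (expR (2 * strain F t (Phi t w)) * expR (2^-1))).
  by rewrite -expRD ler_expR; move: h5 h6; move: (N%:R^-1) => e; lra.
by rewrite ler_wpM2l ?expR_ge0// expR_half_le2.
Qed.

(** [strain_sum] integrated over time; the exponent [2] is at most [sqrt 6]. *)
Lemma stretch_sum N : grid_fine M N -> 32 * M * K <= N%:R ->
  ((kappa' / 32 / N%:R ^+ 2 * \sum_(p : 'I_N * 'I_N)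
      stretch F Phi (grid_center N p.1 p.2))%:E <=
   \int[mu]_(t in `[0%R, 1%R])
     \int[leb2]_(x in torus) (expR (Num.sqrt 6 * frobenius (jac (F t) x)))%:E)%E.
Proof.
move=> fineN Nbig.
pose C : R := kappa' / 32 / N%:R ^+ 2.
have C0 : 0 <= C by rewrite !divr_ge0 ?sqr_ge0// ltW.
pose e (p : 'I_N * 'I_N) t := expR (2 * strain_along F Phi (grid_center N p.1 p.2) t).
have ce p : continuous (e p).
  move=> t; apply: continuous_comp; last exact: continuous_expR.
  by apply: cvgMr; exact: (continuous_strain_along FG flow).
have ie p := integrable_cont01 0 1 (ce p).
have me p : measurable_fun (`[0, 1]%classic : set mR) (EFin \o e p).
  by case/integrableP : (ie p).
have E : (C * \sum_(p : 'I_N * 'I_N) stretch F Phi (grid_center N p.1 p.2))%:E =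
  (\int[mu]_(t in `[0%R, 1%R]) (C%:E * \sum_p (e p t)%:E))%E.
  rewrite ge0_integralZl//; last 2 first.
  - by apply: emeasurable_sum => p; exact: me.
  - by move=> t _; apply: sume_ge0 => p _; rewrite lee_fin expR_ge0.
  rewrite ge0_integral_sum//; last by move=> p t _; rewrite lee_fin expR_ge0.
  rewrite EFinM -sumEFin; congr (_ * _)%E; apply: eq_bigr => p _.
  by rewrite /stretch /Rintegral fineK//; exact: (integrable_fin_num _ (ie p)).
rewrite E; apply: ge0_integral_mono => t.
  by rewrite mule_ge0 ?lee_fin//; apply: sume_ge0 => p _; rewrite lee_fin expR_ge0.
rewrite /= in_itv/= => t01; rewrite sumEFin -EFinM.
have -> : \sum_p e p t = \sum_(p : 'I_N * 'I_N)
    expR (2 * strain F t (Phi t (grid_center N p.1 p.2))).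
  by apply: eq_bigr => p _; rewrite /e /strain_along (clamp_id t01).
apply: (le_trans (strain_sum t01 fineN Nbig)).
apply: ge0_integral_mono => y _; first by rewrite lee_fin expR_ge0.
rewrite lee_fin ler_expR ler_wpM2r ?strain_ge0//.
by rewrite -ler_sqr ?nnegrE ?sqrtr_ge0// sqr_sqrtr//; lra.
Qed.

(** [transport] of the constant [1] from the rows [n <= j < 3n], which fill the
    strip [1/8 <= x_2 < 3/8] of the grid of mesh [1/(8n)]. *)
Lemma inner_strip_area n : (0 < n)%N -> grid_fine M (8 * n) ->
  ((kappa' / 64)%:E <=
   leb2 (flow_inv Phi 1 @^-1` strip (8^-1) (3 / 8) `&` torus))%E.
Proof.
move=> n0 fineN; set U := flow_inv Phi 1 @^-1` _.
have t01 : 0 <= (1 : R) <= 1 by rewrite ler01 lexx.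
have mU : measurable (U : set (mR * mR)).
  apply: preimage_plane_measurable; first exact: (continuous_flow_inv FG flow).
  exact: measurable_strip.
have := @transport R F Phi G M FG flow kappa' kappa'0 hdet 1 (8 * n)
  ('I_(8 * n) * 'I_(2 * n))%type (fun p => p.1) (fun p => n + p.2)%N (fun=> 1) (\1_U)
  t01 fineN.
rewrite integral_indic//; last exact: measurable_torus.
rewrite sumr_const card_prod !card_ord.
have -> : kappa' / 16 / (8 * n)%N%:R ^+ 2 * (1 *+ (8 * n * (2 * n))) = kappa' / 64.
  have n0' : n%:R != 0 :> R by rewrite pnatr_eq0 -lt0n.
  by rewrite !natrM; field.
apply=> //.
- by move=> p; have := ltn_ord p.2; lia.
- by move=> [i j] [i' j'] /= /val_inj -> /addnI/val_inj ->.
- move=> p y [k]; rewrite /grid_box/= !in_itv/= => -[_ /andP[h1 h2]].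
  rewrite indicE mem_set//; exists k.2.
  have n0' : 0 < n%:R :> R by rewrite ltr0n.
  have N0 : 0 < (8 * n)%N%:R :> R by rewrite ltr0n muln_gt0.
  apply/andP; split; [apply: le_trans h1|apply: (lt_le_trans h2)].
    by rewrite ler_pdivlMr// natrM natrD; have := ler0n R p.2; lra.
  rewrite ler_pdivrMr// natrM.
  have : (n + p.2).+1%:R <= (3 * n)%:R :> R.
    by rewrite ler_nat; have := ltn_ord p.2; lia.
  by rewrite natrM; lra.
Qed.

End energy.

(** * Covering the image of a row *)

Section pigeonhole.
Context {R : realType}.

(** The least of [n] of the terms is at most their mean. *)
Lemma row_pigeonhole (A : nat -> R) (N j0 n : nat) : (0 < n)%N -> (j0 + n <= N)%N ->
  (forall j, 0 <= A j) ->
  exists2 j, (j0 <= j < j0 + n)%N & n%:R * A j <= \sum_(j < N) A j.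
Proof.
case: n => // n _ jN A0.
pose j := [arg min_(j < (ord0 : 'I_n.+1)) A (j0 + j)%N]%O.
exists (j0 + j)%N; first by have := ltn_ord j; lia.
have jmin (k : 'I_n.+1) : A (j0 + j)%N <= A (j0 + k)%N.
  by rewrite /j; case: arg_minP => // l _; exact.
apply: (@le_trans _ _ (\sum_(k < n.+1) A (j0 + k)%N)).
  rewrite -[X in X%:R * _](card_ord n.+1) -sumr_const mulr_suml.
  by apply: ler_sum => k _; rewrite mul1r.
rewrite -(big_mkord xpredT A) (big_cat_nat (n := j0)) //=; last by lia.
rewrite (big_cat_nat (n := (j0 + n.+1)%N) (m := j0))//=; last by lia.
have -> : \sum_(j0 <= i < j0 + n.+1) A i = \sum_(k < n.+1) A (j0 + k)%N.
  rewrite -{1}[j0]add0n big_addn addKn big_mkord.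
  by apply: eq_bigr => k _; rewrite addnC.
by rewrite addrCA lerDl addr_ge0// sumr_ge0.
Qed.

End pigeonhole.

Section crossing.
Context {R : realType}.

Lemma band_crossing (g : R -> R) (s s' : R) : continuous g ->
  s <= g 0 <= s' -> ~~ (s <= g 1 <= s') ->
  exists2 u, 0 <= u <= 1 & g u = s \/ g u = s'.
Proof.
move=> cg /andP[g0 g0']; rewrite negb_and -!ltNge => /orP[g1|g1].
  have [c] := @IVT R g 0 1 s ler01 (continuous_subspaceT cg)
    (ltac:(rewrite ge_min le_max (ltW g1) g0 orbT //)).
  by rewrite in_itv/= => c01 gc; exists c => //; left.
have [c] := @IVT R g 0 1 s' ler01 (continuous_subspaceT cg)
  (ltac:(rewrite ge_min le_max (ltW g1) g0' orbT //)).
by rewrite in_itv/= => c01 gc; exists c => //; right.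
Qed.

(** The path from [y] to [y + h] goes first horizontally, then vertically, so that
    a neighbourhood of a crossing point gives an axis-parallel box for [y]. *)
Lemma corner_crossing (f : R * R -> R) (y h : R * R) (s s' : R) : continuous f ->
  s <= f y <= s' -> ~~ (s <= f (y + h) <= s') ->
  exists2 u, 0 <= u <= 1 &
    (f (y + (u * h.1, 0)) = s \/ f (y + (u * h.1, 0)) = s') \/
    (f (y + (h.1, u * h.2)) = s \/ f (y + (h.1, u * h.2)) = s').
Proof.
move=> cf fy fyh.
have cl (a b c d : R) : continuous (fun u : R => f (y + (a * u + b, c * u + d))).
  move=> u; apply: (@continuous_comp _ _ _ (fun u => y + (a * u + b, c * u + d)) f); last exact: cf.
  apply: cvgD; first exact: cvg_cst.
  have c1 : (a * v + b) @[v --> u] --> a * u + b.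
    by apply: cvgD; [apply: cvgMr; exact: cvg_id|exact: cvg_cst].
  have c2 : (c * v + d) @[v --> u] --> c * u + d.
    by apply: cvgD; [apply: cvgMr; exact: cvg_id|exact: cvg_cst].
  exact: (cvg_pair c1 c2).
have [corner|corner] := boolP (s <= f (y + (h.1, 0)) <= s').
  have [|||u u01 hu] := @band_crossing (fun u => f (y + (0 * u + h.1, h.2 * u + 0))) s s'.
  - exact: cl.
  - by rewrite mul0r mulr0 !add0r.
  - by rewrite mul0r mulr1 add0r addr0 -surjective_pairing.
  by exists u => //; right; move: hu; rewrite mul0r add0r addr0 mulrC.
have [|||u u01 hu] := @band_crossing (fun u => f (y + (h.1 * u + 0, 0 * u + 0))) s s'.
- exact: cl.
- by rewrite mul0r mulr0 addr0 (_ : (0, 0) = 0 :> R * R)// addr0.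
- by rewrite mul0r mulr1 !addr0.
by exists u => //; left; move: hu; rewrite mul0r !addr0 mulrC.
Qed.

End crossing.

Section curve.
Context {R : realType}.
Variables (F Phi : R -> R * R -> R * R).
Variables (G : 'I_2 -> R -> R * R -> R * R) (M : R).
Hypothesis FG : field_bounds F G M.
Hypothesis flow : is_lifted_flow F Phi.

Local Notation K := (flow_lip M).

Lemma stretch_ge0 x : 0 <= stretch F Phi x.
Proof. by apply: Rintegral_ge0 => t _; exact: expR_ge0. Qed.

(** On the half-steps of length [1/(2N)] of the row around a centre, [flow_stretch]
    bounds displacements by [sqrt (2 * stretch) / (2N)]. *)
Definition curve_radius (N i j : nat) : R :=
  Num.sqrt (stretch F Phi (grid_center N i j)) / N%:R.

Lemma curve_radius_ge0 N i j : 0 <= curve_radius N i j.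
Proof. by rewrite divr_ge0 ?sqrtr_ge0. Qed.

(** A point of the image of the row comes from a point at distance at most
    [1/(2N)] from some centre of the row. *)
Lemma curve_cover N j (w : R * R) (k : int) : (0 < N)%N -> 32 * M * K <= N%:R ->
  (flow_inv Phi 1 w).2 + k%:~R = (j%:R + 2^-1) / N%:R ->
  exists2 i, (i < N)%N & exists l : int * int,
    `|(w + zvec l).1 - (Phi 1 (grid_center N i j)).1| <= curve_radius N i j /\
    `|(w + zvec l).2 - (Phi 1 (grid_center N i j)).2| <= curve_radius N i j.
Proof.
move=> N0 Nbig; set x := flow_inv Phi 1 w => hk.
have N0' : 0 < N%:R :> R by rewrite ltr0n.
have t01 : 0 <= (1 : R) <= 1 by rewrite ler01 lexx.
pose u := x.1 - (Num.floor x.1)%:~R.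
have /andP[u0 u1] : 0 <= u < 1 by exact: floor_part_itv.
have Nu0 : 0 <= N%:R * u by rewrite mulr_ge0// ltW.
pose i := Num.truncn (N%:R * u).
have /andP[iu ui] := truncn_itv Nu0; rewrite -/i in iu ui.
have iN : (i < N)%N.
  by rewrite -(ltr_nat R) (le_lt_trans iu)// gtr_pMr.
exists i => //; exists (- Num.floor x.1, k).
set c := grid_center N i j; set l := (_, _).
have xl : x + zvec l = (u, (j%:R + 2^-1) / N%:R).
  by rewrite -hk /u /zvec /l/= intrN.
have wl : w + zvec l = Phi 1 (x + zvec l).
  by rewrite (flow_period FG flow _ _ t01) (flow_invK FG flow w t01).
have uc : `|u - c.1| <= 2^-1 / N%:R.
  rewrite -(ler_pM2l N0') -{1}(gtr0_norm N0') -normrM mulrBr /c /grid_center/=.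
  rewrite mulrCA divff ?gt_eqF// mulr1 mulrCA divff ?gt_eqF// mulr1.
  by rewrite ler_norml -natr1 in ui *; apply/andP; split; lra.
have xc : x + zvec l - c = (u - c.1, 0) by rewrite xl /c /grid_center/=; congr pair; rewrite /= subrr.
have M0 := field_M_ge0 FG; have K0 := flow_lip_ge1 FG.
have S0 := stretch_ge0 c.
have hs := flow_stretch FG flow c (x + zvec l).
rewrite -wl xc in hs.
have e2 : expR (8 * M * K * l1norm (u - c.1, 0)) <= 2.
  apply: expR_half_le2; rewrite /l1norm/= normr0 addr0.
  apply: (@le_trans _ _ (8 * M * K * (2^-1 / N%:R))).
    by rewrite ler_wpM2l// !mulr_ge0//; lra.
  by rewrite mulrA ler_pdivrMr//; lra.
have sq : sqn (w + zvec l - Phi 1 c) <= curve_radius N i j ^+ 2.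
  apply: (le_trans hs); rewrite /curve_radius expr_div_n sqr_sqrtr// -/c.
  apply: (@le_trans _ _ (2 * stretch F Phi c * (2^-1 / N%:R) ^+ 2)).
    apply: ler_pM => //; rewrite ?sqn_ge0 ?mulr_ge0 ?expR_ge0 ?ler_wpM2r//.
    rewrite /sqn/= expr0n/= addr0 -(real_normK (num_real (u - c.1))).
    by rewrite ler_sqr ?nnegrE// divr_ge0 // ltW.
  rewrite [2 * _]mulrC -!mulrA ler_wpM2l//.
  by rewrite -exprVn; move: (N%:R^-1) => e; have := sqr_ge0 e; lra.
have r0 := curve_radius_ge0 N i j.
split; rewrite -ler_sqr ?nnegrE// real_normK ?num_real//.
  by apply: le_trans sq; rewrite /sqn lerDl sqr_ge0.
by apply: le_trans sq; rewrite /sqn lerDr sqr_ge0.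
Qed.

End curve.

(** * Points displaced out of the image *)

Section defect.
Context {R : realType}.
Local Notation mR := (measurableTypeR R).

Definition box (c : R * R) (a b : R) : set (mR * mR) :=
  `[c.1 - a, c.1 + a]%classic `*` `[c.2 - b, c.2 + b]%classic.

Lemma measurable_box c a b : measurable (box c a b).
Proof. by apply: measurableX; exact: measurable_itv. Qed.

Lemma leb2_box c a b : 0 <= a -> 0 <= b -> leb2 (box c a b) = (4 * a * b)%:E.
Proof.
move=> a0 b0; rewrite leb2X; [|exact: measurable_itv|exact: measurable_itv].
rewrite !lebesgue_measure_cc; [|lra|lra].
by rewrite -EFinM; congr EFin; ring.
Qed.

Lemma leb2_periodize_box c d a b : 0 <= a < 2^-1 -> 0 <= b < 2^-1 ->
  leb2 (periodize (shift_plane d @^-1` box c a b) `&` torus) = (4 * a * b)%:E.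
Proof.
move=> /andP[a0 a1] /andP[b0 b1].
rewrite (@leb2_periodize _ _ (c - d - (a, b))).
- by rewrite leb2_shift ?leb2_box//; exact: measurable_box.
- by rewrite -[X in measurable X]setTI; apply: measurable_shift_plane => //; exact: measurable_box.
- move=> [x y]; rewrite /box/cell/shift_plane/= !in_itv/= => -[/andP[h1 h2] /andP[h3 h4]].
  by split; apply/andP; split; lra.
Qed.

Variables (F Phi : R -> R * R -> R * R).
Variables (G : 'I_2 -> R -> R * R -> R * R) (M : R).
Hypothesis FG : field_bounds F G M.
Hypothesis flow : is_lifted_flow F Phi.

Local Notation K := (flow_lip M).
Local Notation Psi := (flow_inv Phi 1).

Definition defect (h : R * R) : set (R * R) :=
  [set y | (Psi @^-1` strip (8^-1) (3 / 8)) y /\ ~ (Psi @^-1` strip 0 (2^-1)) (y + h)].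

Let t01 : 0 <= (1 : R) <= 1. Proof. by rewrite ler01 lexx. Qed.

(** The rows [j] and [j'] have heights in [[0, 1/8[] and [[3/8, 1/2[], so the strip
    between them contains the inner strip and is contained in the half torus. The
    path from [y] to [y + h] therefore crosses the image of one of the two rows:
    on its horizontal part, at a point that differs from [y] by at most [eps]
    horizontally, or on its vertical part, at a point that differs from
    [y + (h.1, 0)] by at most [eps] vertically. *)
Lemma defect_cover n j j' eps h y : (0 < n)%N -> (j < n)%N -> (3 * n <= j' < 4 * n)%N ->
  32 * M * K <= (8 * n)%N%:R -> `|h.1| <= eps -> `|h.2| <= eps -> defect h y ->
  exists2 i, (i < 8 * n)%N & exists l : bool, let m := if l then j else j' in
    let c := Phi 1 (grid_center (8 * n) i m) in let r := curve_radius F Phi (8 * n) i m in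
    periodize (shift_plane 0 @^-1` box c (r + eps) r) y \/
    periodize (shift_plane (h.1, 0) @^-1` box c r (r + eps)) y.
Proof.
move=> n0 jn /andP[j1 j2] Nbig h1 h2 [[k /andP[k1 k2]] nP].
have N0 : (0 < 8 * n)%N by lia.
have n0' : 0 < n%:R :> R by rewrite ltr0n.
have N0' : 0 < (8 * n)%N%:R :> R by rewrite ltr0n.
pose s : R := (j%:R + 2^-1) / (8 * n)%N%:R; pose s' : R := (j'%:R + 2^-1) / (8 * n)%N%:R.
have s0 : 0 <= s by rewrite divr_ge0 ?addr_ge0 ?ler0n.
have s8 : s <= 8^-1.
  rewrite ler_pdivrMr// natrM; have : j.+1%:R <= n%:R :> R by rewrite ler_nat.
  by rewrite -natr1; lra.
have s38 : 3 / 8 <= s'.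
  rewrite ler_pdivlMr// natrM; have : (3 * n)%N%:R <= j'%:R :> R by rewrite ler_nat.
  by rewrite natrM; lra.
have s2 : s' < 2^-1.
  rewrite ltr_pdivrMr// natrM; have : j'.+1%:R <= (4 * n)%N%:R :> R by rewrite ler_nat.
  by rewrite -natr1 natrM; lra.
pose f z := (Psi z).2 + k%:~R.
have cf : continuous f.
  have cP := continuous_flow_inv FG flow t01.
  move=> z; apply: cvgD; last exact: cvg_cst.
  by have /cvg_pairP[] := cP z.
have fy : s <= f y <= s' by rewrite /f; apply/andP; split; lra.
have fyh : ~~ (s <= f (y + h) <= s').
  apply/negP => /andP[a b]; apply: nP; exists k.
  by rewrite -/(f _); apply/andP; split; lra.
have line z : f z = s \/ f z = s' -> exists2 i, (i < 8 * n)%N & exists l : bool,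
    let m := if l then j else j' in
    exists p : int * int, box (Phi 1 (grid_center (8 * n) i m))
      (curve_radius F Phi (8 * n) i m) (curve_radius F Phi (8 * n) i m) (z + zvec p).
  case=> fz.
    have [i iN [p [a b]]] := curve_cover FG flow N0 Nbig fz.
    exists i => //; exists true => /=; exists p.
    by split; rewrite /= in_itv/=; [move: a|move: b]; rewrite /= ler_norml => /andP[? ?];
      apply/andP; split; lra.
  have [i iN [p [a b]]] := curve_cover FG flow N0 Nbig fz.
  exists i => //; exists false => /=; exists p.
  by split; rewrite /= in_itv/=; [move: a|move: b]; rewrite /= ler_norml => /andP[? ?];
    apply/andP; split; lra.
have [u /andP[u0 u1]] := corner_crossing cf fy fyh.
have uh (a : R) : `|a| <= eps -> - eps <= u * a <= eps.
  by move=> ha; rewrite -ler_norml normrM ger0_norm// (le_trans _ ha)// ler_piMl.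
case=> /line[i iN [l [p]]]; rewrite /box/= !in_itv/= => -[/andP[a b] /andP[c d]];
  exists i => //; exists l => /=; [left|right]; exists p;
  rewrite /shift_plane/box/= !in_itv/= ?addr0.
  by have /andP[e1 e2] := uh _ h1; split; apply/andP; split; lra.
by have /andP[e1 e2] := uh _ h2; split; apply/andP; split; lra.
Qed.

Lemma measurable_defect h : measurable (defect h : set (mR * mR)).
Proof.
have cP := continuous_flow_inv FG flow t01.
apply: measurableI; first by apply: preimage_plane_measurable => //; exact: measurable_strip.
apply: measurableC.
have mP : measurable (Psi @^-1` strip 0 (2^-1) : set (mR * mR)).
  by apply: preimage_plane_measurable => //; exact: measurable_strip.
by have := measurable_shift_plane h measurableT mP; rewrite setTI.
Qed.

(** Each box has area [4 * r * (r + eps) <= 8 * eps * r]. *)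
Lemma defect_measure n j j' eps h : (0 < n)%N -> (j < n)%N -> (3 * n <= j' < 4 * n)%N ->
  32 * M * K <= (8 * n)%N%:R -> 0 < eps < 8^-1 -> `|h.1| <= eps -> `|h.2| <= eps ->
  (forall i, (i < 8 * n)%N -> curve_radius F Phi (8 * n) i j <= eps) ->
  (forall i, (i < 8 * n)%N -> curve_radius F Phi (8 * n) i j' <= eps) ->
  (leb2 (defect h `&` torus) <= (16 * eps *
    (\sum_(i < 8 * n) curve_radius F Phi (8 * n) i j +
     \sum_(i < 8 * n) curve_radius F Phi (8 * n) i j'))%:E)%E.
Proof.
move=> n0 jn j'n Nbig /andP[e0 e8] h1 h2 rj rj'.
pose m (l : bool) := if l then j else j'.
pose r (p : 'I_(8 * n) * bool) := curve_radius F Phi (8 * n) p.1 (m p.2).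
pose c (p : 'I_(8 * n) * bool) := Phi 1 (grid_center (8 * n) p.1 (m p.2)).
have r0 p : 0 <= r p by exact: curve_radius_ge0.
have re p : r p <= eps by rewrite /r /m; case: p.2; [exact: rj|exact: rj'].
pose A (q : 'I_(8 * n) * bool * bool) : set (mR * mR) :=
  (if q.2 then periodize (shift_plane 0 @^-1` box (c q.1) (r q.1 + eps) (r q.1))
   else periodize (shift_plane (h.1, 0) @^-1` box (c q.1) (r q.1) (r q.1 + eps))) `&` torus.
have mA q : measurable (A q).
  apply: measurableI; last exact: measurable_torus.
  by case: q.2; apply: measurable_periodize; rewrite -[X in measurable X]setTI;
    apply: measurable_shift_plane => //; exact: measurable_box.
have leA q : (leb2 (A q) <= (8 * eps * r q.1)%:E)%E.
  have r0q := r0 q.1; have req := re q.1.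
  have h3 : r q.1 * r q.1 <= eps * r q.1 by rewrite ler_wpM2r.
  by rewrite /A; case: q.2; rewrite leb2_periodize_box ?lee_fin;
    [lra|apply/andP; split; lra|apply/andP; split; lra|lra|apply/andP; split; lra|apply/andP; split; lra].
apply: (@le_trans _ _ (\sum_(q \in setT) leb2 (A q))%E).
  apply: content_sub_fsum; [exact: finite_finset|by move=> q _; exact: mA| |].
    by apply: measurableI; [exact: measurable_defect|exact: measurable_torus].
  move=> y [Dy Ty].
  have [i iN [l hy]] := defect_cover n0 jn j'n Nbig h1 h2 Dy.
  by case: hy => hy; [exists (Ordinal iN, l, true)|exists (Ordinal iN, l, false)].
rewrite (fsbigE (index_enum _) _ (index_enum_uniq _))//; last by move=> q _; rewrite mem_index_enum.
rewrite (eq_bigl xpredT); last by move=> q; rewrite in_setT.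
apply: (@le_trans _ _ (\sum_q (8 * eps * r q.1)%:E)%E); first by apply: lee_sum => q _; exact: leA.
rewrite sumEFin lee_fin -mulr_sumr.
have -> : \sum_(q : 'I_(8 * n) * bool * bool) r q.1 =
    2 * (\sum_(i < 8 * n) r (i, true) + \sum_(i < 8 * n) r (i, false)).
  rewrite -(pair_bigA _ (fun p _ => r p))/= -big_split/= mulr_sumr.
  rewrite (eq_bigr (fun p => 2 * r p)); last first.
    by move=> p _; rewrite sumr_const card_bool mulr_natl.
  rewrite -(pair_bigA _ (fun i l => 2 * r (i, l)))/=.
  by apply: eq_bigr => i _; rewrite big_bool mulrDr.
by rewrite mulrA; have -> : 8 * eps * 2 = 16 * eps by [lra].
Qed.

End defect.

(** * Double counting *)

Section fubini_defect.
Context {R : realType}.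
Local Notation mR := (measurableTypeR R).

Lemma sigma_finite_leb2 : sigma_finite setT (@leb2 R).
Proof.
exists (fun n => box (0, 0) n%:R n%:R).
  apply/seteqP; split=> // -[x y] _.
  exists (Num.truncn (`|x| + `|y|)).+1 => //; rewrite /box/= !in_itv/= add0r add0r -!ler_norml.
  have h := ltW (truncnS_gt (`|x| + `|y|)).
  by split; apply: le_trans h; rewrite ?lerDl ?lerDr.
by move=> n; split; [exact: measurable_box|rewrite leb2_box ?ler0n// ltry].
Qed.

HB.instance Definition _ := Measure_isSigmaFinite.Build _ _ _ (@leb2 R)
  sigma_finite_leb2.

Lemma measurable_add_plane :
  measurable_fun setT (fun z : (mR * mR) * (mR * mR) => (z.1 + z.2 : mR * mR)).
Proof.
have m1 : measurable_fun setT (fun z : (mR * mR) * (mR * mR) => z.1.1 + z.2.1).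
  apply: measurable_funD; apply: (measurableT_comp measurable_fst); exact: measurable_fst || exact: measurable_snd.
have m2 : measurable_fun setT (fun z : (mR * mR) * (mR * mR) => z.1.2 + z.2.2).
  apply: measurable_funD; apply: (measurableT_comp measurable_snd); exact: measurable_fst || exact: measurable_snd.
exact: (measurable_fun_pair m1 m2).
Qed.

Lemma disc_measure (eps : R) : 0 < eps -> exists2 d : R, 0 < d & leb2 (disc eps) = d%:E.
Proof.
move=> e0.
have h1 : (leb2 (disc eps) <= (4 * eps * eps)%:E)%E.
  rewrite -(leb2_box (0, 0) (ltW e0) (ltW e0)); apply: le_measure; rewrite ?inE.
  - exact: measurable_disc.
  - exact: measurable_box.
  move=> h /(disc_bound e0)[]; rewrite !ltr_norml => /andP[a b] /andP[c d].
  by split; rewrite /= in_itv/=; apply/andP; split; lra.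
have h2 : ((4 * (eps / 2) * (eps / 2))%:E <= leb2 (disc eps))%E.
  have e2 : 0 <= eps / 2 by rewrite divr_ge0// ltW.
  rewrite -(leb2_box (0, 0) e2 e2); apply: le_measure; rewrite ?inE.
  - exact: measurable_box.
  - exact: measurable_disc.
  move=> [x y]; rewrite /box /disc /sqn/= !in_itv/= !add0r => -[hx hy].
  have aux (u : R) : - (eps / 2) <= u <= eps / 2 -> u ^+ 2 <= (eps / 2) ^+ 2.
    by rewrite -ler_norml => hu; rewrite -(real_normK (num_real u)) ler_sqr ?nnegrE// divr_ge0// ltW.
  have ep : 0 < eps ^+ 2 by rewrite exprn_gt0.
  by have := aux _ hx; have := aux _ hy; lra.
have dfin : leb2 (disc eps) \is a fin_num.
  by rewrite ge0_fin_numE ?measure_ge0//; apply: le_lt_trans h1 _; rewrite ltry.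
exists (fine (leb2 (disc eps))); last by rewrite fineK.
rewrite -lte_fin fineK//; apply: lt_le_trans h2.
by rewrite lte_fin !mulr_gt0// divr_gt0.
Qed.

(** Both sides estimate the measure of the set of pairs [(y, h)] with [y] in [U],
    [h] in the disc and [y + h] outside [P]. *)
Lemma double_counting (eps kappa b : R) (U P : set (R * R)) : 0 < eps ->
  measurable (U : set (mR * mR)) -> measurable (P : set (mR * mR)) ->
  (forall y, U y -> (kappa%:E * leb2 (disc eps) <= leb2 (disc eps `&` [set h | ~ P (y + h)%R]))%E) ->
  (forall h, disc eps h -> (leb2 (U `&` [set y | ~ P (y + h)%R]) <= b%:E)%E) ->
  0 <= kappa -> 0 <= b -> (kappa%:E * leb2 U <= b%:E)%E.
Proof.
move=> e0 mU mP lowb upb k0 b0.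
have [d d0 dE] := disc_measure e0.
pose A : set ((mR * mR) * (mR * mR)) :=
  [set z | [/\ U z.1, disc eps z.2 & ~ P (z.1 + z.2)]].
have mA : measurable A.
  rewrite (_ : A = (fst @^-1` U `&` snd @^-1` disc eps) `&`
    ~` ((fun z : (mR * mR) * (mR * mR) => (z.1 + z.2 : mR * mR)) @^-1` P)); last first.
    by apply/seteqP; split=> z /= => [[]|[[]]].
  apply: measurableI; last first.
    by apply: measurableC; rewrite -[X in measurable X]setTI; exact: measurable_add_plane.
  apply: measurableI; rewrite -[X in measurable X]setTI.
    exact: measurable_fst.
  by apply: measurable_snd => //; exact: measurable_disc.
have secx y : xsection A y = if y \in U then disc eps `&` [set h | ~ P (y + h)] else set0.
  apply/seteqP; split=> h; rewrite /xsection/= inE /A/=.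
    by move=> [Uy dh nP]; rewrite mem_set.
  by case: ifPn => // /set_mem Uy [].
have secy h : ysection A h = if h \in disc eps then U `&` [set y | ~ P (y + h)] else set0.
  apply/seteqP; split=> y; rewrite /ysection/= inE /A/=.
    by move=> [Uy dh nP]; rewrite mem_set.
  by case: ifPn => // /set_mem Uy [].
have fub : (\int[leb2]_y (leb2 (xsection A y)) = \int[leb2]_h (leb2 (ysection A h)))%E.
  have := indic_fubini_tonelli (@leb2 R) (@leb2 R) mA.
  by rewrite (indic_fubini_tonelli_FE _ mA) (indic_fubini_tonelli_GE _ mA).
have kd0 : 0 <= kappa * d := mulr_ge0 k0 (ltW d0).
have l1 : ((kappa * d)%:E * leb2 U <= \int[leb2]_y (leb2 (xsection A y)))%E.
  have E1 := @integral_cst _ _ _ (@leb2 R) U mU (kappa * d)%:E.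
  rewrite -E1.
  rewrite [leLHS]integral_mkcond; apply: ge0_integral_mono => y _.
    by rewrite patchE; case: ifP => _; [rewrite lee_fin; exact: kd0|exact: lexx].
  rewrite patchE secx; case: ifPn => [/set_mem Uy|_]; last by rewrite measure0.
  by rewrite EFinM -dE; exact: lowb.
have l2 : (\int[leb2]_h (leb2 (ysection A h)) <= b%:E * d%:E)%E.
  have E2 : (\int[leb2]_(y in disc eps) b%:E = b%:E * d%:E)%E :=
    etrans (integral_cst (@leb2 R) (measurable_disc eps) b%:E)
      (congr1 (fun z => b%:E * z)%E dE).
  rewrite -E2.
  rewrite [leRHS]integral_mkcond; apply: ge0_integral_mono => h _; first exact: measure_ge0.
  rewrite patchE secy; case: ifPn => [/set_mem Dh|_]; last by rewrite measure0.
  exact: upb.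
have h : ((kappa * d)%:E * leb2 U <= b%:E * d%:E)%E.
  by apply: le_trans l1 _; rewrite fub; exact: l2.
clear -h d0; move: h; rewrite EFinM [(kappa%:E * d%:E)%E]muleC -muleA [(b%:E * _)%E]muleC.
by rewrite (@lee_pmul2l R d%:E).
Qed.

End fubini_defect.

(** * Consequences of mixing *)

Section mixing.
Context {R : realType}.
Local Notation mR := (measurableTypeR R).
Variables (F Phi : R -> R * R -> R * R).
Variables (G : 'I_2 -> R -> R * R -> R * R) (M : R).
Hypothesis FG : field_bounds F G M.
Hypothesis flow : is_lifted_flow F Phi.

Local Notation Psi := (flow_inv Phi 1).

Let t01 : 0 <= (1 : R) <= 1. Proof. by rewrite ler01 lexx. Qed.

Lemma torus_proj_zvec (x : R * R) k : torus x -> torus_proj (x + zvec k) = x.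
Proof.
case: x k => [a b] [k l] [/=]; rewrite !in_itv/= => ha hb.
have aux (u : R) (n : int) : 0 <= u < 1 -> Num.floor (u + n%:~R) = n.
  by move=> /andP[u0 u1]; apply: floor_def; rewrite intrD; apply/andP; split; lra.
by rewrite /torus_proj/= !aux// !addrK.
Qed.

Lemma image_lower_half :
  (fun x => torus_proj (Phi 1 x)) @` lower_half =
  torus `&` Psi @^-1` strip 0 (2^-1).
Proof.
apply/seteqP; split=> [_ [x [Tx hx] <-]|y [Ty [k hk]]].
  split; first exact: torus_proj_torus.
  rewrite /= torus_projE -zvecN (flow_inv_period FG flow _ _ t01) (flowK FG flow _ t01).
  by apply/periodic_strip; exists 0; rewrite addr0.
set x := Psi y in hk.
have xk2 : torus_proj x = (x.1 - (Num.floor x.1)%:~R, x.2 + k%:~R).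
  congr pair; congr (_ + _); rewrite (_ : Num.floor x.2 = - k) ?intrN ?opprK//.
  by apply: floor_def; rewrite intrD !intrN; move: hk => /andP[? ?]; apply/andP; split; lra.
exists (torus_proj x).
  by split; [exact: torus_proj_torus|rewrite xk2].
rewrite [torus_proj x]torus_projE -zvecN (flow_period FG flow _ _ t01) (flow_invK FG flow _ t01).
exact: torus_proj_zvec.
Qed.

(** The upper bound on the area of the image in a ball bounds the area of the
    complement from below. *)
Lemma mixing_lower (kappa eps : R) y : 0 < eps < 2^-1 ->
  mixes kappa (fun x => torus_proj (Phi 1 x)) lower_half eps -> torus y ->
  (kappa%:E * leb2 (disc eps) <=
   leb2 (disc eps `&` [set h | ~ (Psi @^-1` strip 0 (2^-1)) (y + h)%R]))%E.
Proof.
move=> e0 mix Ty; have [_] := mix y Ty.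
have [d d0 dE] := disc_measure (proj1 (andP e0)).
pose P : set (R * R) := Psi @^-1` strip 0 (2^-1).
have mP : measurable (P : set (mR * mR)).
  apply: preimage_plane_measurable; first exact: (continuous_flow_inv FG flow).
  exact: measurable_strip.
have pP : periodic P by apply: (periodic_flow_inv FG flow) => //; exact: periodic_strip.
rewrite image_lower_half setIA (_ : torus_ball y eps `&` torus = torus_ball y eps); last first.
  by apply/seteqP; split=> x; [case|move=> h; split=> //; case: h].
rewrite (leb2_torus_ball _ e0 mP pP).
rewrite -[X in (_ * leb2 X)%E]setIT (leb2_torus_ball _ e0 (P := setT))//.
rewrite (_ : disc eps `&` [set h | [set: R * R] (y + h)] = disc eps); last first.
  by apply/seteqP; split=> x // [].
pose Q : set (mR * mR) := [set h | P (y + h)].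
have mQ : measurable Q.
  have := measurable_shift_plane y measurableT mP; rewrite setTI; congr measurable.
  by apply/seteqP; split=> h; rewrite /shift_plane/Q/= addrC.
rewrite -/Q => hQ.
have split_disc : leb2 (disc eps) = (leb2 (disc eps `&` Q) + leb2 (disc eps `&` ~` Q))%E.
  rewrite -measureU.
  - by rewrite -setIUr setUv setIT.
  - by apply: measurableI => //; exact: measurable_disc.
  - by apply: measurableI; [exact: measurable_disc|exact: measurableC].
  - by rewrite setIACA setICr setI0.
have hle : (leb2 (disc eps) <= (1 - kappa)%:E * leb2 (disc eps) + leb2 (disc eps `&` ~` Q))%E.
  by rewrite {1}split_disc leeD2r.
have -> : disc eps `&` [set h | ~ P (y + h)] = disc eps `&` ~` Q by [].
move: hle; rewrite dE -!EFinM.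
have [r rE] : exists r, r = leb2 (disc eps `&` ~` Q) by eexists.
rewrite -rE; case: r {rE} => [r||]; rewrite ?leey//.
  by rewrite -EFinD !lee_fin; lra.
Qed.

End mixing.

(** * The lower bound for the energy *)

Section lower_bound.
Context {R : realType}.
Local Notation mR := (measurableTypeR R).
Local Notation mu := (@lebesgue_measure R).

(** The Cauchy-Schwarz inequality for the sum of the radii of the boxes that cover
    the image of a row. *)
Lemma sum_radius_le (N : nat) (S : nat -> R) (L : R) : (0 < N)%N -> 0 < L ->
  (forall i, 0 <= S i) -> \sum_(i < N) S i <= N%:R * L ^+ 2 ->
  \sum_(i < N) (Num.sqrt (S i) / N%:R) <= L.
Proof.
move=> N0 L0 S0 hS; have N0' : 0 < N%:R :> R by rewrite ltr0n.
(* The arithmetic-geometric mean inequality, with the weight that balances the two terms. *)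
have amgm i : Num.sqrt (S i) <= (S i / L + L) / 2.
  rewrite ler_pdivlMr// -(ler_pM2r L0) mulrDl divfK ?gt_eqF//.
  have := sqr_sqrtr (S0 i); have := sqr_ge0 (Num.sqrt (S i) - L).
  by move: (Num.sqrt (S i)) => s h1 <-; lra.
rewrite -mulr_suml ler_pdivrMr//.
apply: le_trans (ler_sum _ (fun (i : 'I_N) _ => amgm i)) _.
rewrite -mulr_suml big_split/= -mulr_suml sumr_const card_ord -mulr_natl.
have : (\sum_(i < N) S i) / L <= N%:R * L.
  by rewrite ler_pdivrMr// -mulrA -expr2.
by lra.
Qed.

Lemma energy_algebra (k k' e I : R) : 0 < k' ->
  (k * (k' / 64)) ^+ 2 <= (32 * e) ^+ 2 * (256 * I / k') ->
  k ^+ 2 * k' ^+ 3 / 2 ^+ 30 <= I * e ^+ 2.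
Proof.
move=> k'0 /(ler_wpM2r (ltW k'0)); rewrite -[leRHS]mulrA divfK ?gt_eqF// => h.
rewrite ler_pdivrMr ?exprn_gt0//.
have -> : 2 ^+ 30 = (8 ^+ 2) ^+ 2 * (32 ^+ 2 * (16 ^+ 2)) :> R.
  have -> : 8 = 2 ^+ 3 :> R by ring.
  have -> : 32 = 2 ^+ 5 :> R by ring.
  have -> : 16 = 2 ^+ 4 :> R by ring.
  by rewrite -!exprM -!exprD.
by lra.
Qed.

(** The integrand is at least [1]; this settles the case of large [eps]. *)
Lemma energy_ge1 (F : R -> R * R -> R * R) :
  (1 <= \int[mu]_(t in `[0%R, 1%R])
     \int[leb2]_(x in torus) (expR (Num.sqrt 6 * frobenius (jac (F t) x)))%:E)%E.
Proof.
have leb2_torus : leb2 (torus : set (mR * mR)) = 1%E.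
  rewrite leb2X; [|exact: measurable_itv|exact: measurable_itv].
  by rewrite lebesgue_measure_itv/= lte_fin ltr01 oppr0 adde0 mule1.
have E1 : (\int[mu]_(t in `[0%R, 1%R]) 1 = 1 :> \bar R)%E.
  by rewrite integral_cst//= mul1e lebesgue_measure_itv/= lte_fin ltr01 oppr0 adde0.
rewrite -[leLHS]E1; apply: ge0_integral_mono => // t _.
rewrite -leb2_torus -[leLHS]mul1e -integral_cst; last exact: measurable_torus.
apply: ge0_integral_mono => // x _.
by rewrite lee_fin -expR0 ler_expR mulr_ge0// sqrtr_ge0.
Qed.

Variables (F Phi : R -> R * R -> R * R).
Variables (G : 'I_2 -> R -> R * R -> R * R) (M : R).
Hypothesis FG : field_bounds F G M.
Hypothesis flow : is_lifted_flow F Phi.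

Local Notation K := (flow_lip M).

Variables kappa kappa' : R.
Hypothesis kappa0 : 0 < kappa.
Hypothesis kappa'0 : 0 < kappa'.
Hypothesis hdet : forall t x, 0 <= t <= 1 -> torus x -> kappa' <= `| \det (jac (Phi t) x) |.

(** The sum over the whole grid is at most [32 * N^2 * I / kappa'], and there are
    [n = N / 8] rows to choose from. *)
Lemma exists_short_row n j0 (I : R) : (0 < n)%N -> (j0 + n <= 8 * n)%N ->
  kappa' / 32 / (8 * n)%N%:R ^+ 2 * (\sum_(p : 'I_(8 * n) * 'I_(8 * n))
      stretch F Phi (grid_center (8 * n) p.1 p.2)) <= I ->
  exists2 j, (j0 <= j < j0 + n)%N &
    \sum_(i < 8 * n) stretch F Phi (grid_center (8 * n) i j) <=
      (8 * n)%N%:R * (256 * I / kappa').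
Proof.
move=> n0 jn hI; set N := (8 * n)%N in jn hI *.
have N0' : 0 < N%:R :> R by rewrite ltr0n muln_gt0.
have n0' : 0 < n%:R :> R by rewrite ltr0n.
have NE : N%:R = 8 * n%:R :> R by rewrite /N natrM.
pose A j := \sum_(i < N) stretch F Phi (grid_center N i j).
have A0 j : 0 <= A j by apply: sumr_ge0 => i _; exact: stretch_ge0.
have [j jb jA] := row_pigeonhole n0 jn A0.
exists j => //; rewrite -/(A j).
have TE : \sum_(p : 'I_N * 'I_N) stretch F Phi (grid_center N p.1 p.2) = \sum_(j < N) A j.
  by rewrite exchange_big/= pair_bigA.
rewrite TE in hI; move: jA; set T := \sum_(j < N) A j in hI * => jA.
have hT : T <= I * (32 * N%:R ^+ 2 / kappa').
  rewrite -ler_pdivrMr; last by rewrite divr_gt0// mulr_gt0// exprn_gt0.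
  by apply: le_trans hI; rewrite le_eqVlt; apply/orP; left; apply/eqP; field; rewrite !gt_eqF.
rewrite -(ler_pM2l n0'); apply: (le_trans jA); apply: (le_trans hT).
rewrite le_eqVlt; apply/orP; left; apply/eqP; rewrite NE; field.
by rewrite gt_eqF.
Qed.

(** The image of the inner strip has area at least [kappa' / 64], and [kappa]
    times this area is at most [32 * eps * L] by [double_counting], where [L^2] is
    a multiple of [I / kappa']; squaring gives the bound. *)
Lemma mixing_energy_bound (eps I : R) : 0 < eps < 8^-1 -> 1 <= I ->
  mixes kappa (fun x => torus_proj (Phi 1 x)) lower_half eps ->
  (\int[mu]_(t in `[0%R, 1%R])
     \int[leb2]_(x in torus) (expR (Num.sqrt 6 * frobenius (jac (F t) x)))%:E = I%:E)%E ->
  kappa ^+ 2 * kappa' ^+ 3 / 2 ^+ 30 / eps ^+ 2 <= I.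
Proof.
move=> e08 I1 mix IE; have /andP[e0 e8] := e08.
have e02 : 0 < eps < 2^-1 by rewrite e0; lra.
have M0 := field_M_ge0 FG; have K0 := flow_lip_ge0 M.
have C0 := taylor_const_ge0 FG.
(* [L] bounds the sum of the radii along each of the two chosen rows. *)
have [L [L0 L2]] : exists L : R, 0 < L /\ L ^+ 2 = 256 * I / kappa'.
  have Ik : 0 < I / kappa' by rewrite divr_gt0// (lt_le_trans ltr01).
  exists (16 * Num.sqrt (I / kappa')); split; first by rewrite mulr_gt0// sqrtr_gt0.
  by rewrite exprMn sqr_sqrtr ?(ltW Ik)//; rewrite -mulrA; congr (_ * _); lra.
have eL : 16 * eps * (L + L) = 32 * eps * L by ring.
have b1 : 0 <= 4 * K * (taylor_const M + 1) by rewrite !mulr_ge0// addr_ge0.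
have b2 : 0 <= 32 * M * K by rewrite !mulr_ge0.
have b3 : 0 <= L ^+ 2 / eps ^+ 2 by rewrite divr_ge0// sqr_ge0.
(* The three terms make the grid fine enough for [transport], for [curve_cover],
   and for every single radius to be at most [eps]. *)
have [n [n0 nb]] : exists n, (0 < n)%N /\
    4 * K * (taylor_const M + 1) + 32 * M * K + L ^+ 2 / eps ^+ 2 < n%:R.
  by eexists; split; last exact: truncnS_gt.
have n0' : 0 < n%:R :> R by rewrite ltr0n.
pose N := (8 * n)%N.
have NE : N%:R = 8 * n%:R :> R by rewrite /N natrM.
have N0' : 0 < N%:R :> R by rewrite NE mulr_gt0.
have fineN : grid_fine M N by rewrite /grid_fine NE; lra.
have Nbig : 32 * M * K <= N%:R by rewrite NE; lra.
have NL : L ^+ 2 / eps ^+ 2 <= N%:R by rewrite NE; lra.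
have jn0 : (0 + n <= 8 * n)%N by clear -n; lia.
have jn3 : (3 * n + n <= 8 * n)%N by clear -n; lia.
have hI := stretch_sum FG flow kappa'0 hdet fineN Nbig.
rewrite IE lee_fin in hI.
have [j /andP[_ jn] hj] := @exists_short_row n 0 I n0 jn0 hI.
have [j' j'n hj'] := @exists_short_row n (3 * n) I n0 jn3 hI.
rewrite -/N -L2 in hj hj'.
have j'n4 : (3 * n <= j' < 4 * n)%N by clear -j'n; lia.
have hr (k : nat) : \sum_(i < N) stretch F Phi (grid_center N i k) <= N%:R * L ^+ 2 ->
    forall i, (i < N)%N -> curve_radius F Phi N i k <= eps.
  move=> hk i iN; have S0 := stretch_ge0 F Phi (grid_center N i k).
  rewrite -ler_sqr ?nnegrE ?curve_radius_ge0 ?(ltW e0)//.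
  rewrite /curve_radius expr_div_n sqr_sqrtr// ler_pdivrMr ?exprn_gt0//.
  have h1 : stretch F Phi (grid_center N i k) <= N%:R * L ^+ 2.
    apply: le_trans hk; rewrite (bigD1 (Ordinal iN))//= lerDl.
    by apply: sumr_ge0 => l _; exact: stretch_ge0.
  have h2 : L ^+ 2 <= N%:R * eps ^+ 2 by rewrite -ler_pdivrMr ?exprn_gt0.
  apply: (le_trans h1); apply: le_trans (ler_wpM2l (ltW N0') h2) _.
  by rewrite mulrA mulrC -expr2.
have sumr (k : nat) : \sum_(i < N) stretch F Phi (grid_center N i k) <= N%:R * L ^+ 2 ->
    \sum_(i < N) curve_radius F Phi N i k <= L.
  move=> hk; have NN : (0 < N)%N by rewrite -(ltr0n R).
  exact: (@sum_radius_le N (fun i => stretch F Phi (grid_center N i k)) L NN L0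
    (fun i => stretch_ge0 F Phi _) hk).
have t01 : 0 <= (1 : R) <= 1 by rewrite ler01 lexx.
pose U : set (R * R) := flow_inv Phi 1 @^-1` strip (8^-1) (3 / 8) `&` torus.
pose P : set (R * R) := flow_inv Phi 1 @^-1` strip 0 (2^-1).
have cP := continuous_flow_inv FG flow t01.
have mU : measurable (U : set (mR * mR)).
  apply: measurableI; last exact: measurable_torus.
  by apply: preimage_plane_measurable => //; exact: measurable_strip.
have mP : measurable (P : set (mR * mR)).
  by apply: preimage_plane_measurable => //; exact: measurable_strip.
have upper h : disc eps h -> (leb2 (U `&` [set y | ~ P (y + h)%R]) <= (32 * eps * L)%:E)%E.
  move=> /(disc_bound e0)[h1 h2].
  rewrite (_ : U `&` _ = defect Phi h `&` torus); last first.
    by apply/seteqP; split=> y [[? ?] ?].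
  apply: le_trans (defect_measure FG flow n0 jn j'n4 Nbig e08 (ltW h1) (ltW h2) (hr _ hj) (hr _ hj')) _.
  have c0 : 0 <= 16 * eps by rewrite mulr_ge0 ?(ltW e0).
  rewrite lee_fin; apply: le_trans (ler_wpM2l c0 (lerD (sumr _ hj) (sumr _ hj'))) _.
  by rewrite eL.
have lower y : U y -> (kappa%:E * leb2 (disc eps) <=
    leb2 (disc eps `&` [set h | ~ P (y + h)%R]))%E.
  by move=> [_ Ty]; exact: (mixing_lower FG flow e02 mix Ty).
have b0 : 0 <= 32 * eps * L by rewrite !mulr_ge0// ltW.
have := double_counting e0 mU mP lower upper (ltW kappa0) b0.
have := inner_strip_area FG flow kappa'0 hdet n0 fineN; rewrite -/U => hU h.
have {h hU} : (kappa%:E * (kappa' / 64)%:E <= (32 * eps * L)%:E)%E.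
  by apply: le_trans h; rewrite lee_wpmul2l// lee_fin ltW.
rewrite -EFinM lee_fin => h.
have k0 : 0 <= kappa * (kappa' / 64) by rewrite mulr_ge0 ?divr_ge0// ltW.
have : (kappa * (kappa' / 64)) ^+ 2 <= (32 * eps * L) ^+ 2 by rewrite ler_sqr.
rewrite [leRHS]exprMn L2 => {}h.
by rewrite ler_pdivrMr ?exprn_gt0//; exact: energy_algebra.
Qed.

End lower_bound.

Theorem mainTheorem2 (R : realType) (kappa kappa' : R)
    (hkappa : 0 < kappa < 2^-1) (hkappa' : 0 < kappa') :
  exists2 C : R, 0 < C &
    forall (eps : R) (F Phi : R -> R * R -> R * R),
      0 < eps ->
      smooth_torus_field F ->
      is_lifted_flow F Phi ->
      (forall t x, 0 <= t <= 1 -> torus x -> kappa' <= `| \det (jac (Phi t) x) |) ->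
      mixes kappa (fun x => torus_proj (Phi 1 x)) lower_half eps ->
      ((C / eps ^+ 2)%:E <=
        \int[lebesgue_measure]_(t in `[0%R, 1%R])
          \int[leb2]_(x in torus)
            (expR (Num.sqrt 6 * frobenius (jac (F t) x)))%:E)%E.
Proof.
have /andP[kappa0 _] := hkappa.
pose D : R := kappa ^+ 2 * kappa' ^+ 3 / 2 ^+ 30.
have D0 : 0 < D by rewrite divr_gt0// mulr_gt0 ?exprn_gt0.
exists (Num.min D 64^-1); first by rewrite lt_min D0 invr_gt0 ltr0n.
move=> eps F Phi e0 smooth flow hdet mix.
have [G [M FG]] := smooth_field_bounds smooth.
have e2 : 0 < eps ^+ 2 by rewrite exprn_gt0.
have I1 := energy_ge1 F.
(* For [eps >= 1/8] the bound [1] of [energy_ge1] suffices, whence the [1/64] in the constant. *)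
have [e8|e8] := ltP eps (8^-1); last first.
  apply: le_trans I1; rewrite lee_fin ler_pdivrMr// mul1r.
  rewrite (@le_trans _ _ 64^-1) ?ge_min ?lexx ?orbT//.
  have : (8^-1) ^+ 2 <= eps ^+ 2 by rewrite ler_sqr ?nnegrE ?(ltW e0).
  by lra.
move: I1 (mixing_energy_bound FG flow kappa0 hkappa' hdet (eps := eps)).
case: (X in (1%:E <= X)%E -> _) => [I I1 bound|_ _|]; [|by rewrite leey|by []].
rewrite lee_fin; apply: le_trans (bound I _ _ mix erefl); last 2 first.
- by rewrite e0.
- by rewrite -lee_fin.
by rewrite ler_wpM2r ?invr_ge0 ?(ltW e2)// ge_min lexx.
Qed.
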